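(* (Completeness for proofs) A sequent $D\vdash\boldsymbol\Lambda$ is derivable in the proof system if and only if $D\models\boldsymbol\Lambda$. In particular, for any positive logical behaviour $\mathbf P$ and positive proof $P$, $P\vdash x_0:\mathbf P$ is derivable if and only if $P\in\mathbf P$; similarly, for any negative logical behaviour $\mathbf N$ and negative proof $N$, $N\vdash\mathbf N$ is derivable if and only if $N\in\mathbf N$.
   Context: Fix a signature (names $A$ with arities $\mathsf{ar}$) and a countable set of variables. Designs are possibly infinite terms coinductively generated by: positive $P ::= \Omega \mid \bigwedge\{S_i : i\in I\}$ ($I$ arbitrary); predesigns $S ::= N_0\,|\,\overline{a}\langle N_1,\dots,N_n\rangle$ ($\mathsf{ar}(a)=n$); negative $N ::= x \mid \sum a(\vec x).P_a$ (one component $a(\vec x).P_a$ for each $a\in A$, $\vec x$ distinct bound variables of length $\mathsf{ar}(a)$); up to $\alpha$-renaming and set-like treatment of conjunctions, $\bigwedge\{S\}=S$, $\maltese:=\bigwedge\emptyset$. Reduction: $P\rightsquigarrow Q$ iff $P$ has a conjunct $(\sum a(\vec x).P_a)\,|\,\overline b\langle\vec N\rangle$ and $Q=P_b[\vec N/\vec x]$. Normal form (corecursive): $[\![P]\!]=\Omega$ if some reduction sequence from $P$ is infinite or ends in $\Omega$; otherwise $[\![P]\!]$ is the conjunction of all $x\,|\,\overline a\langle[\![\vec N]\!]\rangle$ with $x|\overline a\langle\vec N\rangle$ a conjunct of some $Q$, $P\rightsquigarrow^*Q$; $[\![\sum a(\vec x).P_a]\!]=\sum a(\vec x).[\![P_a]\!]$,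 $[\![x]\!]=x$. Standard design: $\neq\Omega$ and generated by $P::=\Omega\mid\bigwedge\{S_i\}$, $S::=x\,|\,\overline a\langle N_1,\dots,N_n\rangle$, $N::=\sum a(\vec x).P_a$. Atomic positive: standard, free variables among a fixed variable $x_0$; atomic negative: standard and closed. $P\perp N$ iff $[\![P[N/x_0]]\!]=\maltese$; $\mathbf{X}^\perp$ = atomic designs of opposite polarity orthogonal to every element of $\mathbf{X}$; a behaviour is a set $\mathbf X$ of atomic designs of one polarity with $\mathbf X^{\perp\perp}=\mathbf X$. Positive context $\boldsymbol\Gamma=x_1:\mathbf P_1,\dots,x_n:\mathbf P_n$ (distinct variables, positive behaviours), $\mathsf{fv}(\boldsymbol\Gamma)=\{x_1,\dots,x_n\}$; negative context $\boldsymbol\Gamma,\mathbf N$. $P\models\boldsymbol\Gamma$ iff $P$ standard, $\mathsf{fv}(P)\subseteq\mathsf{fv}(\boldsymbol\Gamma)$, $[\![P[K_1/x_1,\dots,K_n/x_n]]\!]=\maltese$ for all $K_i\in\mathbf P_i^\perp$; $N\models\boldsymbol\Gamma,\mathbf N$ iff $N$ standard, $\mathsf{fv}(N)\subseteq\mathsf{fv}(\boldsymbol\Gamma)$, $[\![Q[N[K_1/x_1,\dots,K_n/x_n]/x_0]]\!]=\maltese$ for all $K_i\in\mathbf P_i^\perp$, $Q\in\mathbf N^\perp$. Logical connective $\alpha=(z_1,\dots,z_n,\alpha_0)$: distinct variables $z_i$, finite set $\alpha_0$ of negative actions $a(\vec x)$ ($\vec x$ a list of $\mathsf{ar}(a)$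 distinct variables among the $z_i$) with distinct names, identified up to renaming. $\overline a\langle\mathbf N_1,\dots,\mathbf N_m\rangle:=\{x_0\,|\,\overline a\langle N_1,\dots,N_m\rangle : N_j\in\mathbf N_j\}$; $\overline\alpha\langle\mathbf N_1,\dots,\mathbf N_n\rangle:=\big(\bigcup_{a(\vec x)\in\alpha_0}\overline a\langle\mathbf N_{i_1},\dots,\mathbf N_{i_m}\rangle\big)^{\perp\perp}$ with $\vec x=z_{i_1},\dots,z_{i_m}$; $\alpha(\mathbf P_1,\dots,\mathbf P_n):=\overline\alpha\langle\mathbf P_1^\perp,\dots,\mathbf P_n^\perp\rangle^\perp$; logical behaviours are those built inductively by these two constructions from logical behaviours. A proof is a standard design all of whose conjunctions are unary. A sequent is $P\vdash\boldsymbol\Gamma$ ($P$ positive proof, $\boldsymbol\Gamma$ positive context of logical behaviours, $\mathsf{fv}(P)\subseteq\mathsf{fv}(\boldsymbol\Gamma)$) or $N\vdash\boldsymbol\Gamma,\mathbf N$ ($N$ negative proof, $\mathbf N$ negative logical behaviour, $\mathsf{fv}(N)\subseteq\mathsf{fv}(\boldsymbol\Gamma)$). Rules (derivations are finite trees): positive rule $(\overline\alpha,\overline a)$: from $M_j\vdash\boldsymbol\Gamma,\mathbf N_{i_j}$ ($j=1,\dots,m$) infer $z\,|\,\overline a\langle M_1,\dots,M_m\rangle\vdash\boldsymbol\Gamma$, provided $z:\overline\alpha\langle\mathbf N_1,\dots,\mathbf N_n\rangle$ is in $\boldsymbol\Gamma$, $a(\vec x)\in\alpha_0$, $\vec x=z_{i_1},\dots,z_{i_m}$;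 negative rule $(\alpha)$: from $P_a\vdash\boldsymbol\Gamma,z_{i_1}:\mathbf P_{i_1},\dots,z_{i_m}:\mathbf P_{i_m}$ for every $a(\vec x)\in\alpha_0$ ($\vec x=z_{i_1},\dots,z_{i_m}$ fresh for $\boldsymbol\Gamma$) infer $\sum a(\vec x).P_a\vdash\boldsymbol\Gamma,\alpha(\mathbf P_1,\dots,\mathbf P_n)$, the components for actions not in $\alpha_0$ being arbitrary. *)

(* Defs.v *)
From mathcomp Require Import all_boot.
From mathcomp Require Import boolp classical_sets cardinality.
From Stdlib Require Import Relation_Operators.
From Stdlib Require List.

Set Implicit Arguments.
Unset Strict Implicit.
Unset Printing Implicit Defensive.

Local Open Scope classical_set_scope.

Record signature := Signature { name :> Type; ar : name -> nat }.

(** Designs are coinductive terms whose free variables range over a type [V].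
    Binding is by nested scopes, which accounts for alpha-renaming: in the
    component [a(x_0, ..., x_{m-1}).P_a] of a sum, [P_a] has its free variables
    in [V + 'I_m], where [inr j] stands for the bound [x_j].

    The set-like reading of conjunctions is carried by the bisimilarity
    [eq_pos], [eq_pre], [eq_neg] below: two designs of the mathematical text are
    equal when they are bisimilar.  A predesign [S] seen as a positive design
    is [single S]. *)

CoInductive pos (A : signature) (V : Type) : Type :=
| Omega
| Conj (J : Type) (S : J -> pre A V)
with pre (A : signature) (V : Type) : Type :=
| Cut (N : neg A V) (a : A) (M : 'I_(ar a) -> neg A V)
with neg (A : signature) (V : Type) : Type :=
| Var (x : V)
| Sum (F : forall a : A, pos A (V + 'I_(ar a))).

Arguments Omega {A V}.
Arguments Conj {A V} J S.
Arguments Cut {A V} N a M.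
Arguments Var {A V} x.
Arguments Sum {A V} F.

Definition single A V (S : pre A V) : pos A V := Conj unit (fun _ => S).

Definition daimon A V : pos A V := Conj void (of_void (pre A V)).
Arguments daimon {A V}.

Definition conjunct A V (P : pos A V) (S : pre A V) : Prop :=
  match P with
  | Omega => False
  | Conj J T => exists i : J, T i = S
  end.

CoInductive eq_pos A V : pos A V -> pos A V -> Prop :=
| Eq_pos P Q of
    (P = Omega <-> Q = Omega) &
    (forall S, conjunct P S -> exists2 T, conjunct Q T & eq_pre S T) &
    (forall T, conjunct Q T -> exists2 S, conjunct P S & eq_pre S T) :
    eq_pos P Q
with eq_pre A V : pre A V -> pre A V -> Prop :=
| Eq_Cut N N' a (M M' : 'I_(ar a) -> neg A V) of
    eq_neg N N' & (forall j, eq_neg (M j) (M' j)) :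
    eq_pre (Cut N a M) (Cut N' a M')
with eq_neg A V : neg A V -> neg A V -> Prop :=
| Eq_Var x : eq_neg (Var x) (Var x)
| Eq_Sum F F' of (forall a, eq_pos (F a) (F' a)) : eq_neg (Sum F) (Sum F').

Inductive fv_pos A V (x : V) : pos A V -> Prop :=
| Fv_conj P S of conjunct P S & fv_pre x S : fv_pos x P
with fv_pre A V (x : V) : pre A V -> Prop :=
| Fv_head N a M of fv_neg x N : fv_pre x (Cut N a M)
| Fv_arg N a M j of fv_neg x (M j) : fv_pre x (Cut N a M)
with fv_neg A V (x : V) : neg A V -> Prop :=
| Fv_Var : fv_neg x (Var x)
| Fv_Sum F a of fv_pos (inl x) (F a) : fv_neg x (Sum F).

Definition lift_ren V W m (r : V -> W) (v : V + 'I_m) : W + 'I_m :=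
  match v with inl x => inl (r x) | inr j => inr j end.

CoFixpoint ren_pos A V W (r : V -> W) (P : pos A V) : pos A W :=
  match P with
  | Omega => Omega
  | Conj J T => Conj J (fun i => ren_pre r (T i))
  end
with ren_pre A V W (r : V -> W) (S : pre A V) : pre A W :=
  match S with
  | Cut N a M => Cut (ren_neg r N) a (fun j => ren_neg r (M j))
  end
with ren_neg A V W (r : V -> W) (N : neg A V) : neg A W :=
  match N with
  | Var x => Var (r x)
  | Sum F => Sum (fun a => ren_pos (lift_ren r) (F a))
  end.

Definition lift_sub A V W m (s : V -> neg A W) (v : V + 'I_m) :
    neg A (W + 'I_m) :=
  match v with inl x => ren_neg inl (s x) | inr j => Var (inr j) end.

CoFixpoint sub_pos A V W (s : V -> neg A W) (P : pos A V) : pos A W :=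
  match P with
  | Omega => Omega
  | Conj J T => Conj J (fun i => sub_pre s (T i))
  end
with sub_pre A V W (s : V -> neg A W) (S : pre A V) : pre A W :=
  match S with
  | Cut N a M => Cut (sub_neg s N) a (fun j => sub_neg s (M j))
  end
with sub_neg A V W (s : V -> neg A W) (N : neg A V) : neg A W :=
  match N with
  | Var x => s x
  | Sum F => Sum (fun a => sub_pos (lift_sub s) (F a))
  end.

Definition inst A V m (M : 'I_m -> neg A V) (v : V + 'I_m) : neg A V :=
  match v with inl x => Var x | inr j => M j end.

Definition red A V (P Q : pos A V) : Prop :=
  exists F b M,
    conjunct P (Cut (Sum F) b M) /\ Q = sub_pos (inst M) (F b).

Definition reds A V : pos A V -> pos A V -> Prop :=
  clos_refl_trans_1n (pos A V) (@red A V).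

Definition diverges A V (P : pos A V) : Prop :=
  (exists f : nat -> pos A V, f 0 = P /\ forall n, red (f n) (f n.+1))
  \/ reds P Omega.

(** The conjuncts [x | a<M>] of the reducts of [P] are enumerated along the
    reduction paths of [P], and not along the reducts themselves: the type of
    designs is too large to index a conjunction.  [nf_conjunct] below gives the
    intended description. *)

Record head_pre (A : signature) (V : Type) :=
  Head { hvar : V; hname : A; harg : 'I_(ar hname) -> neg A V }.

Record family T := Family { idx : Type; elt : idx -> T }.

Definition empty_family T : family T := Family (of_void T).
Definition unit_family T (t : T) : family T := Family (fun _ : unit => t).
Definition sum_family T (J : Type) (f : J -> family T) : family T :=
  Family (fun k : {i : J & idx (f i)} => elt (projT2 k)).

Fixpoint heads_at A V (n : nat) (P : pos A V) : family (head_pre A V) :=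
  match P with
  | Omega => empty_family _
  | Conj J T => sum_family (fun i : J =>
      match T i, n with
      | Cut (Var x) a M, 0 => unit_family (Head x M)
      | Cut (Sum F) b M, n'.+1 => heads_at n' (sub_pos (inst M) (F b))
      | _, _ => empty_family _
      end)
  end.

Definition heads A V (P : pos A V) : family (head_pre A V) :=
  sum_family (fun n => heads_at n P).

CoFixpoint nf_pos A V (P : pos A V) : pos A V :=
  if pselect (diverges P) then Omega
  else Conj (idx (heads P)) (fun k =>
         match elt k with
         | Head x a M => Cut (Var x) a (fun j => nf_neg (M j))
         end)
with nf_neg A V (N : neg A V) : neg A V :=
  match N with
  | Var x => Var x
  | Sum F => Sum (fun a => nf_pos (F a))
  end.

Definition unfold_pos A V (P : pos A V) : pos A V :=
  match P with Omega => Omega | Conj J T => Conj J T end.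

Lemma unfold_posE A V (P : pos A V) : P = unfold_pos P.
Proof. by case: P. Qed.

Lemma heads_atP A V n (P : pos A V) h :
  (exists k, elt (f := heads_at n P) k = h) ->
  exists2 Q, reds P Q & conjunct Q (Cut (Var (hvar h)) (hname h) (@harg _ _ h)).
Proof.
elim: n P => [|n IH] [|J T] /= [] [] //= i.
  case E: (T i) => [[x|F] a M] //= [] <- /=.
  by exists (Conj J T); [exact: rt1n_refl | exists i].
case E: (T i) => [[x|F] a M] //= k kh.
have [Q rQ cQ] := IH _ (ex_intro _ k kh); exists Q => //.
apply: Relation_Operators.rt1n_trans rQ.
by exists F, a, M; split=> //; exists i.
Qed.

Lemma headsP A V (P : pos A V) h :
  (exists k, elt (f := heads P) k = h) <->
  exists2 Q, reds P Q & conjunct Q (Cut (Var (hvar h)) (hname h) (@harg _ _ h)).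
Proof.
split=> [[[n k] kh]|[Q PQ]]; first apply: heads_atP (ex_intro _ k kh).
elim: PQ => {P Q} [[|J T] //= [i Ti]|P R Q [F [b [M [cM ->]]]] _ IH /IH].
- have [k kh] : exists k, elt (f := heads_at 0 (Conj J T)) k = h.
    rewrite /=; have : exists k, elt (f := match T i with
      | Cut (Var x) a M => unit_family (Head x M)
      | _ => empty_family _ end) k = h.
      by rewrite Ti; exists tt; case: h {Ti}.
    by case=> k kh; exists (existT _ i k).
  by exists (existT _ 0 k).
- case=> [[n k] /= kh]; case: P cM => // J T [i Ti].
  have [k' k'h] : exists k, elt (f := heads_at n.+1 (Conj J T)) k = h.
    rewrite /=; have : exists k, elt (f := match T i with
      | Cut (Sum F) b M => heads_at n (sub_pos (inst M) (F b))
      | _ => empty_family _ end) k = h.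
      by rewrite Ti; exists k.
    by case=> k1 k1h; exists (existT _ i k1).
  by exists (existT _ n.+1 k').
Qed.

Lemma nf_posE A V (P : pos A V) :
  nf_pos P =
  if pselect (diverges P) then Omega
  else Conj (idx (heads P)) (fun k =>
         let h := elt k in Cut (Var (hvar h)) (hname h)
                               (fun j => nf_neg (@harg _ _ h j))).
Proof.
rewrite [LHS]unfold_posE /=; case: pselect => //= _.
by congr Conj; apply: funext => k; case: (elt _).
Qed.

Lemma nf_diverges A V (P : pos A V) : diverges P -> nf_pos P = Omega.
Proof. by move=> dP; rewrite nf_posE; case: pselect. Qed.

Lemma nf_conjunct A V (P : pos A V) : ~ diverges P ->
  nf_pos P <> Omega /\
  forall S, conjunct (nf_pos P) S <->
    exists Q x a M, [/\ reds P Q, conjunct Q (Cut (Var x) a M) &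
                        S = Cut (Var x) a (fun j => nf_neg (M j))].
Proof.
move=> nP; rewrite nf_posE; case: pselect => //= ?; split=> // S.
split=> [[k <-]|[Q [x [a [M [PQ cQ ->]]]]]].
- have [Q PQ cQ] := (headsP P (elt (f := heads P) k)).1 (ex_intro _ k erefl).
  by exists Q; do 3!eexists; split; [exact: PQ | exact: cQ | ].
- have [k kh] := (headsP P (Head x M)).2 (ex_intro2 _ _ Q PQ cQ).
  by exists k; move: kh; rewrite /heads /= => ->.
Qed.

CoInductive std_pos A V : pos A V -> Prop :=
| Std_pos P of (forall S, conjunct P S -> std_pre S) : std_pos P
with std_pre A V : pre A V -> Prop :=
| Std_pre x a M of (forall j, std_neg (M j)) : std_pre (Cut (Var x) a M)
with std_neg A V : neg A V -> Prop :=
| Std_neg F of (forall a, std_pos (F a)) : std_neg (Sum F).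

Definition standard_pos A V (P : pos A V) : Prop := P <> Omega /\ std_pos P.
Definition standard_neg A V (N : neg A V) : Prop := std_neg N.

(** Every conjunction is unary, as a set of predesigns up to bisimilarity. *)
CoInductive unary_pos A V : pos A V -> Prop :=
| Unary_pos P of
    (P = Omega \/ exists2 S, conjunct P S & forall T, conjunct P T -> eq_pre S T) &
    (forall S, conjunct P S -> unary_pre S) :
    unary_pos P
with unary_pre A V : pre A V -> Prop :=
| Unary_pre N a M of unary_neg N & (forall j, unary_neg (M j)) :
    unary_pre (Cut N a M)
with unary_neg A V : neg A V -> Prop :=
| Unary_Var x : unary_neg (Var x)
| Unary_Sum F of (forall a, unary_pos (F a)) : unary_neg (Sum F).

Definition proof_pos A V (P : pos A V) : Prop := standard_pos P /\ unary_pos P.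
Definition proof_neg A V (N : neg A V) : Prop := standard_neg N /\ unary_neg N.

(** The countable set of variables is [nat]. *)

Notation design_pos A := (pos A nat).
Notation design_neg A := (neg A nat).

Definition x0 : nat := 0.

Definition atomic_pos A (P : design_pos A) : Prop :=
  standard_pos P /\ forall x, fv_pos x P -> x = x0.

Definition atomic_neg A (N : design_neg A) : Prop :=
  standard_neg N /\ forall x, ~ fv_neg x N.

(** [P[N/x0]] *)
Definition plug A (P : design_pos A) (N : design_neg A) : design_pos A :=
  sub_pos (fun v => if v == x0 then N else Var v) P.

Definition orthogonal A (P : design_pos A) (N : design_neg A) : Prop :=
  eq_pos (nf_pos (plug P N)) daimon.

Definition orth_pos A (X : set (design_pos A)) : set (design_neg A) :=
  [set N | atomic_neg N /\ forall P, X P -> orthogonal P N].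

Definition orth_neg A (X : set (design_neg A)) : set (design_pos A) :=
  [set P | atomic_pos P /\ forall N, X N -> orthogonal P N].

Definition behaviour_pos A (X : set (design_pos A)) : Prop :=
  orth_neg (orth_pos X) = X.
Definition behaviour_neg A (X : set (design_neg A)) : Prop :=
  orth_pos (orth_neg X) = X.

Definition context A := seq (nat * set (design_pos A)).

Definition dom A (G : context A) : seq nat := map fst G.

Definition is_context A (G : context A) : Prop :=
  uniq (dom G) /\ forall x X, List.In (x, X) G -> behaviour_pos X.

(** [[K_1/x_1, ..., K_n/x_n]], where [K_i] is [K x_i] *)
Definition closing A (G : context A) (K : nat -> design_neg A) (v : nat) :
    design_neg A :=
  if v \in dom G then K v else Var v.

Definition counter A (G : context A) (K : nat -> design_neg A) : Prop :=
  forall x X, List.In (x, X) G -> orth_pos X (K x).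

Definition models_pos A (G : context A) (P : design_pos A) : Prop :=
  [/\ standard_pos P,
      forall x, fv_pos x P -> x \in dom G &
      forall K, counter G K -> eq_pos (nf_pos (sub_pos (closing G K) P)) daimon].

Definition models_neg A (G : context A) (X : set (design_neg A))
    (N : design_neg A) : Prop :=
  [/\ standard_neg N,
      forall x, fv_neg x N -> x \in dom G &
      forall K Q, counter G K -> orth_neg X Q ->
        eq_pos (nf_pos (plug Q (sub_neg (closing G K) N))) daimon].

(** The variables [z_1, ..., z_n] of a connective are represented by their
    positions, so that connectives are identified up to renaming. *)

Record action (A : signature) (n : nat) := Action {
  act_name : A;
  act_vars : (ar act_name).-tuple 'I_n;
  act_uniq : uniq act_vars }.

Record connective (A : signature) := Connective {
  conn_ar : nat;
  conn_acts : set (action A conn_ar);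
  conn_fin : finite_set conn_acts;
  conn_names : forall b c, conn_acts b -> conn_acts c ->
    act_name b = act_name c -> b = c }.

Arguments conn_acts {A} c : rename.

Definition act_pos (A : signature) (a : A) (X : 'I_(ar a) -> set (design_neg A)) :
    set (design_pos A) :=
  [set P | exists2 N : 'I_(ar a) -> design_neg A,
             forall j, X j (N j) & eq_pos P (single (Cut (Var x0) a N))].

Definition conn_pos A (al : connective A)
    (X : 'I_(conn_ar al) -> set (design_neg A)) : set (design_pos A) :=
  orth_neg (orth_pos
    (\bigcup_(b in conn_acts al)
       act_pos (fun j : 'I_(ar (act_name b)) => X (tnth (act_vars b) j)))).

Definition conn_neg A (al : connective A)
    (X : 'I_(conn_ar al) -> set (design_pos A)) : set (design_neg A) :=
  orth_pos (conn_pos (fun i => orth_pos (X i))).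

Arguments conn_pos {A} al X.
Arguments conn_neg {A} al X.

Inductive logical_pos A : set (design_pos A) -> Prop :=
| Logical_pos (al : connective A) X of
    (forall i, logical_neg (X i)) : logical_pos (conn_pos al X)
with logical_neg A : set (design_neg A) -> Prop :=
| Logical_neg (al : connective A) X of
    (forall i, logical_pos (X i)) : logical_neg (conn_neg al X).

Definition logical_context A (G : context A) : Prop :=
  is_context G /\ forall x X, List.In (x, X) G -> logical_pos X.

Definition sequent_pos A (G : context A) (P : design_pos A) : Prop :=
  [/\ logical_context G, proof_pos P & forall x, fv_pos x P -> x \in dom G].

Definition sequent_neg A (G : context A) (X : set (design_neg A))
    (N : design_neg A) : Prop :=
  [/\ logical_context G, logical_neg X, proof_neg N &
      forall x, fv_neg x N -> x \in dom G].

(** In the negative rule, [y] gives the fresh names [z_1, ..., z_n] of the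
    variables of the connective; [act_body] names the bound variables of the
    component of [b] accordingly, and [act_context] is the list of the
    [z_{i_j} : P_{i_j}]. *)

Definition act_body A n (b : action A n) (y : 'I_n -> nat)
    (P : pos A (nat + 'I_(ar (act_name b)))) : design_pos A :=
  ren_pos (fun v => match v with
                    | inl x => x
                    | inr j => y (tnth (act_vars b) j)
                    end) P.

Definition act_context A n (b : action A n) (y : 'I_n -> nat)
    (X : 'I_n -> set (design_pos A)) : context A :=
  [seq (y i, X i) | i <- act_vars b].

(** The side condition [sequent_neg G _ (Sum F)] prevents the names [y] from
    capturing free variables of [F].  The conclusion of the positive rule is
    taken up to equality of designs; this makes both judgements invariant. *)
Inductive derivable_pos A : context A -> design_pos A -> Prop :=
| Positive_rule (G : context A) (P : design_pos A) (z : nat)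
    (al : connective A) (X : 'I_(conn_ar al) -> set (design_neg A))
    (b : action A (conn_ar al)) (M : 'I_(ar (act_name b)) -> design_neg A) of
    sequent_pos G P &
    (forall i, logical_neg (X i)) &
    List.In (z, conn_pos al X) G &
    conn_acts al b &
    eq_pos P (single (Cut (Var z) (act_name b) M)) &
    (forall j, derivable_neg G (X (tnth (act_vars b) j)) (M j)) :
    derivable_pos G P
with derivable_neg A :
    context A -> set (design_neg A) -> design_neg A -> Prop :=
| Negative_rule (G : context A)
    (al : connective A) (X : 'I_(conn_ar al) -> set (design_pos A))
    (F : forall a : A, pos A (nat + 'I_(ar a)))
    (y : 'I_(conn_ar al) -> nat) of
    sequent_neg G (conn_neg al X) (Sum F) &
    (forall i, logical_pos (X i)) &
    injective y &
    (forall i, y i \notin dom G) &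
    (forall b, conn_acts al b ->
       derivable_pos (G ++ act_context b y X)
                     (act_body y (F (act_name b)))) :
    derivable_neg G (conn_neg al X) (Sum F).

(* Main.v *)
Require Import Defs.
From mathcomp Require Import all_boot.
From mathcomp Require Import boolp classical_sets.
From Stdlib Require Import Relation_Operators.
From Stdlib Require List.

(** A closed design converges when its reduction terminates, through all its
    conjunctions, without meeting Omega or a head variable; this is an inductive
    predicate, and normalizing to the daimon amounts to convergence.

    Soundness is an induction on derivations.  The designs [M[K]] met there are
    not standard, so they have to be replaced by their normal forms before being
    opposed to elements of an orthogonal: convergence of an iterated closure is
    not affected by normalizing some of the designs of the closure.

    Completeness: if a sequent is not derivable, following underivable premises
    gives a branch, which is infinite or ends with Omega or with a positive
    action that is not available in the context.  Each variable [z] of the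
    branch is given the closed standard design [K z] which answers an action
    [a] by the conjunction of all the answers that the branch gives to
    [z | a<...>], and by Omega if the branch ends there.  Then [K z] belongs to
    the orthogonal of the behaviour of [z], by induction on that behaviour, but
    the interaction of the designs of the branch with [K] follows the branch
    forever or meets Omega. *)

Set Implicit Arguments.
Unset Strict Implicit.
Unset Printing Implicit Defensive.

Local Notation "P =p Q" := (eq_pos P Q) (at level 70).
Local Notation "N =n M" := (eq_neg N M) (at level 70).

(** * Bisimilarity *)

(** Contexts are never consumed, so a branch may play the same action on the same variable many
    times and follow a different premise each time: no single answer could serve. This is why the
    counter-design uses conjunctions although proofs do not. Convergence requires every choice of
    conjunct to converge, and the branch is one of these choices, so it is enough that it exists as
    a reduction path. Merging the answers is harmless because a variable keeps its behaviour along
    the branch and an action of a connective is determined by its name.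

    Only positive sequents need a branch: the negative rule is semantically invertible, which
    reduces a negative sequent to its components.

    Designs are equal up to bisimilarity only. The laws of substitution therefore need coinduction,
    and the inductions on convergence carry a bisimilarity along. *)

Lemma eq_pre_inv A V N a (M : 'I_(ar a) -> neg A V) T :
  eq_pre (Cut N a M) T ->
  exists N' M', [/\ T = Cut N' a M', N =n N' & forall j, M j =n M' j].
Proof.
(* The type of [M] depends on [a], so plain inversion would give an equality of dependent pairs; a
   predicate defined by matching avoids it. The same device recurs below. *)
move=> e; pose rel (S T : pre A V) := match S with Cut N a M =>
  exists N' M', [/\ T = Cut N' a M', N =n N' & forall j, M j =n M' j] end.
suff: rel (Cut N a M) T by [].
by case: e => {N a M} N N' a M M' ? ?; exists N', M'.
Qed.

(** Coinduction with the guard condition discharged once and for all. The relations range over all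
    scopes, since a sum extends the scope, and the alternative [N =n N'] makes it a principle up to
    known bisimilarities. *)
Lemma eq_coind A (Rp : forall V, pos A V -> pos A V -> Prop)
    (Rn : forall V, neg A V -> neg A V -> Prop) :
  (forall V P Q, Rp V P Q ->
     [/\ P = Omega <-> Q = Omega,
         forall N a M, conjunct P (Cut N a M) -> exists N' M',
           [/\ conjunct Q (Cut N' a M'), Rn V N N' & forall j, Rn V (M j) (M' j)] &
         forall N' a M', conjunct Q (Cut N' a M') -> exists N M,
           [/\ conjunct P (Cut N a M), Rn V N N' & forall j, Rn V (M j) (M' j)]]) ->
  (forall V N N', Rn V N N' -> N =n N' \/
     exists F F', [/\ N = Sum F, N' = Sum F' & forall a, Rp _ (F a) (F' a)]) ->
  (forall V P Q, Rp V P Q -> P =p Q) /\ (forall V N N', Rn V N N' -> N =n N').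
Proof.
move=> Hp Hn.
have Hp' V P Q : Rp V P Q ->
  [/\ P = Omega <-> Q = Omega,
      forall S, conjunct P S -> exists2 T, conjunct Q T &
        match S with Cut N a M => exists N' M',
          [/\ T = Cut N' a M', Rn V N N' & forall j, Rn V (M j) (M' j)] end &
      forall T, conjunct Q T -> exists2 S, conjunct P S &
        match S with Cut N a M => exists N' M',
          [/\ T = Cut N' a M', Rn V N N' & forall j, Rn V (M j) (M' j)] end].
  case/Hp=> eO hl hr; split=> // [[N a M] /hl|[N a M] /hr].
    by case=> N' [M' [c n m]]; exists (Cut N' a M') => //; exists N', M'.
  by case=> N' [M' [c n m]]; exists (Cut N' a M') => //; exists N, M.
(* A transparent local definition: the guard check has to see that the corecursive call passed as
   [en] ends up under [Eq_Cut]. *)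
pose pre_of V (en : forall N N', Rn V N N' -> N =n N') S T
  (r : match S with Cut N a M => exists N' M',
          [/\ T = Cut N' a M', Rn V N N' & forall j, Rn V (M j) (M' j)] end) : eq_pre S T :=
  match S return match S with Cut N a M => exists N' M',
          [/\ T = Cut N' a M', Rn V N N' & forall j, Rn V (M j) (M' j)] end -> eq_pre S T with
  | Cut N a M => fun r => match r with ex_intro N' (ex_intro M' (And3 e n m)) =>
      match esym e in _ = T return eq_pre _ T with
      | erefl => @Eq_Cut A V N N' a M M' (en _ _ n) (fun j => en _ _ (m j)) end end
  end r.
pose cp := cofix cp V P Q (r : Rp V P Q) : P =p Q :=
  match Hp' V P Q r with And3 eO hl hr =>
    Eq_pos eO
      (fun S cS => match hl S cS with ex_intro2 T cT r =>
         ex_intro2 _ _ T cT (pre_of V (cn V) S T r) end)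
      (fun T cT => match hr T cT with ex_intro2 S1 cS r =>
         ex_intro2 _ _ S1 cS (pre_of V (cn V) S1 T r) end) end
with cn V N N' (r : Rn V N N') : N =n N' :=
  match Hn V N N' r with
  | or_introl e => e
  | or_intror (ex_intro F (ex_intro F' (And3 e e' h))) =>
      match esym e in _ = N return N =n N' with erefl =>
        match esym e' in _ = N' return Sum F =n N' with erefl =>
          Eq_Sum (fun a => cp _ _ _ (h a)) end end
  end for cp.
split; first exact: cp.
by move=> V N N' /Hn[//|[F [F' [-> -> h]]]]; constructor=> a; exact: cp.
Qed.

Lemma eq_posO A V (P Q : pos A V) : P =p Q -> P = Omega <-> Q = Omega.
Proof. by case. Qed.

Lemma eq_posl A V (P Q : pos A V) N a M :
  P =p Q -> conjunct P (Cut N a M) -> exists N' M',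
    [/\ conjunct Q (Cut N' a M'), N =n N' & forall j, M j =n M' j].
Proof.
case=> {}P {}Q _ h _ /h[T cT /eq_pre_inv[N' [M' [E n m]]]].
by subst T; exists N', M'.
Qed.

Lemma eq_neg_Var A V (x : V) (N : neg A V) : Var x =n N -> N = Var x.
Proof.
pose rel (N M : neg A V) := if N is Var x then M = Var x else True.
move=> e; suff: rel (Var x) N by [].
by case: e.
Qed.

Lemma eq_neg_Sum A V F (N : neg A V) : Sum F =n N ->
  exists2 F', N = Sum F' & forall a, F a =p F' a.
Proof.
pose rel (N M : neg A V) :=
  if N is Sum F then exists2 F', M = Sum F' & forall a, F a =p F' a else True.
move=> e; suff: rel (Sum F) N by [].
by case: e => //= {}F F' h; exists F'.
Qed.

Lemma bisim_refl A : (forall V (P : pos A V), P =p P) /\ (forall V (N : neg A V), N =n N).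
Proof.
have [] : (forall V (P Q : pos A V), P = Q -> P =p Q) /\
          (forall V (N M : neg A V), N = M -> N =n M).
  apply: eq_coind => [V P _ <-|V [x|F] _ <-].
  - by split=> // N a M c; exists N, M.
  - by left; constructor.
  - by right; exists F, F.
by move=> h1 h2; split=> V P; [apply: h1 | apply: h2].
Qed.

Lemma eqp_refl A V (P : pos A V) : P =p P. Proof. exact: (bisim_refl A).1. Qed.
Lemma eqn_refl A V (N : neg A V) : N =n N. Proof. exact: (bisim_refl A).2. Qed.
#[local] Hint Resolve eqp_refl eqn_refl : core.

Lemma eq_pre_invr A V S N' a (M' : 'I_(ar a) -> neg A V) :
  eq_pre S (Cut N' a M') ->
  exists N M, [/\ S = Cut N a M, N =n N' & forall j, M j =n M' j].
Proof.
move=> e; pose rel (S T : pre A V) := match T with Cut N' a M' =>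
  exists N M, [/\ S = Cut N a M, N =n N' & forall j, M j =n M' j] end.
suff: rel S (Cut N' a M') by [].
by case: e => N N1 b M M1 ? ?; exists N, M.
Qed.

Lemma eq_posr A V (P Q : pos A V) N' a M' :
  P =p Q -> conjunct Q (Cut N' a M') -> exists N M,
    [/\ conjunct P (Cut N a M), N =n N' & forall j, M j =n M' j].
Proof.
case=> {}P {}Q _ _ h /h[T cT /eq_pre_invr[N [M [E n m]]]].
by subst T; exists N, M.
Qed.

Lemma eq_neg_inv A V (N M : neg A V) : N =n M ->
  (exists2 x, N = Var x & M = Var x) \/
  exists F F', [/\ N = Sum F, M = Sum F' & forall a, F a =p F' a].
Proof. by case=> [x|F F' h]; [left; exists x | right; exists F, F']. Qed.

Lemma bisim_sym A : (forall V (P Q : pos A V), Q =p P -> P =p Q) /\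
  (forall V (N M : neg A V), M =n N -> N =n M).
Proof.
apply: eq_coind.
  move=> V P Q e; split=> [|N a M c|N a M c]; first by rewrite (eq_posO e).
    by have [N' [M' [c' n m]]] := eq_posr e c; exists N', M'.
  by have [N' [M' [c' n m]]] := eq_posl e c; exists N', M'.
move=> V N M /eq_neg_inv[[x -> ->]|[F [F' [-> -> h]]]]; first by left.
by right; exists F', F.
Qed.

Lemma eqp_sym A V (P Q : pos A V) : P =p Q -> Q =p P.
Proof. by move/(bisim_sym A).1. Qed.
Lemma eqn_sym A V (P Q : neg A V) : P =n Q -> Q =n P.
Proof. by move/(bisim_sym A).2. Qed.

Lemma bisim_trans A :
  (forall V (P R : pos A V), (exists2 Q, P =p Q & Q =p R) -> P =p R) /\
  (forall V (N L : neg A V), (exists2 M, N =n M & M =n L) -> N =n L).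
Proof.
apply: eq_coind => V P R [Q e1 e2].
  split=> [|N a M c|N a M c]; first by rewrite (eq_posO e1) (eq_posO e2).
    have [N' [M' [c' n m]]] := eq_posl e1 c.
    have [N2 [M2 [c2 n2 m2]]] := eq_posl e2 c'.
    by exists N2, M2; split=> // [|j]; [exists N' | exists (M' j)].
  have [N' [M' [c' n m]]] := eq_posr e2 c.
  have [N2 [M2 [c2 n2 m2]]] := eq_posr e1 c'.
  by exists N2, M2; split=> // [|j]; [exists N' | exists (M' j)].
case: (eq_neg_inv e1) e2 => [[x -> ->] e2|[F [F' [-> -> h]]]].
  by left.
case/eq_neg_Sum=> F2 -> h2; right; exists F, F2; split=> // a.
by exists (F' a).
Qed.

Lemma eqp_trans A V (Q P R : pos A V) : P =p Q -> Q =p R -> P =p R.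
Proof. by move=> ? ?; apply: (bisim_trans A).1; exists Q. Qed.
Lemma eqn_trans A V (Q P R : neg A V) : P =n Q -> Q =n R -> P =n R.
Proof. by move=> ? ?; apply: (bisim_trans A).2; exists Q. Qed.

(** * Renaming and substitution, conjunct by conjunct *)

Definition unfold_pre A V (S : pre A V) := match S with Cut N a M => Cut N a M end.
Lemma unfold_preE A V (S : pre A V) : S = unfold_pre S.
Proof. by case: S. Qed.
Definition unfold_neg A V (N : neg A V) :=
  match N with Var x => Var x | Sum F => Sum F end.
Lemma unfold_negE A V (N : neg A V) : N = unfold_neg N.
Proof. by case: N. Qed.

Lemma ren_Sum A V W (r : V -> W) F :
  ren_neg r (Sum F : neg A V) = Sum (fun a => ren_pos (lift_ren r) (F a)).
Proof. by rewrite [LHS]unfold_negE. Qed.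
Lemma ren_Var A V W (r : V -> W) x : ren_neg r (Var x : neg A V) = Var (r x).
Proof. by rewrite [LHS]unfold_negE. Qed.
Lemma sub_Sum A V W (s : V -> neg A W) F :
  sub_neg s (Sum F) = Sum (fun a => sub_pos (lift_sub s) (F a)).
Proof. by rewrite [LHS]unfold_negE. Qed.
Lemma sub_Var A V W (s : V -> neg A W) x : sub_neg s (Var x) = s x.
Proof. by rewrite [LHS]unfold_negE [RHS]unfold_negE. Qed.

Lemma ren_Omega A V W (r : V -> W) (P : pos A V) : ren_pos r P = Omega <-> P = Omega.
Proof. by rewrite [ren_pos r P]unfold_posE; case: P. Qed.
Lemma sub_Omega A V W (s : V -> neg A W) (P : pos A V) :
  sub_pos s P = Omega <-> P = Omega.
Proof. by rewrite [sub_pos s P]unfold_posE; case: P. Qed.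

Lemma ren_conj A V W (r : V -> W) (P : pos A V) N a M :
  conjunct P (Cut N a M) ->
  conjunct (ren_pos r P) (Cut (ren_neg r N) a (fun j => ren_neg r (M j))).
Proof.
rewrite [ren_pos r P]unfold_posE; case: P => //= J T [i Ti]; exists i.
by rewrite [LHS]unfold_preE Ti.
Qed.

Lemma sub_conj A V W (s : V -> neg A W) (P : pos A V) N a M :
  conjunct P (Cut N a M) ->
  conjunct (sub_pos s P) (Cut (sub_neg s N) a (fun j => sub_neg s (M j))).
Proof.
rewrite [sub_pos s P]unfold_posE; case: P => //= J T [i Ti]; exists i.
by rewrite [LHS]unfold_preE Ti.
Qed.

Lemma ren_conjV A V W (r : V -> W) (P : pos A V) N' a M' :
  conjunct (ren_pos r P) (Cut N' a M') -> exists N M, [/\ conjunct P (Cut N a M),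
    N' = ren_neg r N & M' = fun j => ren_neg r (M j)].
Proof.
pose rel (S : pre A W) := match S with Cut N' a M' =>
  exists N M, [/\ conjunct P (Cut N a M),
    N' = ren_neg r N & M' = fun j => ren_neg r (M j)] end.
suff h S : conjunct (ren_pos r P) S -> rel S by apply: h.
rewrite [ren_pos r P]unfold_posE {}/rel; case: P => //= J T [i <-].
by case E: (T i) => [N b M] /=; exists N, M; split=> //; exists i.
Qed.

Lemma sub_conjV A V W (s : V -> neg A W) (P : pos A V) N' a M' :
  conjunct (sub_pos s P) (Cut N' a M') -> exists N M, [/\ conjunct P (Cut N a M),
    N' = sub_neg s N & M' = fun j => sub_neg s (M j)].
Proof.
pose rel (S : pre A W) := match S with Cut N' a M' =>
  exists N M, [/\ conjunct P (Cut N a M),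
    N' = sub_neg s N & M' = fun j => sub_neg s (M j)] end.
suff h S : conjunct (sub_pos s P) S -> rel S by apply: h.
rewrite [sub_pos s P]unfold_posE {}/rel; case: P => //= J T [i <-].
by case E: (T i) => [N b M] /=; exists N, M; split=> //; exists i.
Qed.

Lemma ren_eq A :
  (forall W (P Q : pos A W), (exists V (r : V -> W) P0 Q0,
     [/\ P0 =p Q0, P = ren_pos r P0 & Q = ren_pos r Q0]) -> P =p Q) /\
  (forall W (N M : neg A W), (exists V (r : V -> W) N0 M0,
     [/\ N0 =n M0, N = ren_neg r N0 & M = ren_neg r M0]) -> N =n M).
Proof.
apply: eq_coind => W _ _ [V [r [P [Q [e -> ->]]]]].
  split=> [|N a M|N a M]; first by rewrite !ren_Omega (eq_posO e).
    case/ren_conjV=> [N0 [M0 [/(eq_posl e)[N' [M' [c n m]]] -> ->]]].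
    exists (ren_neg r N'), (fun j => ren_neg r (M' j)).
    split=> [||j]; first exact: ren_conj.
      by exists V, r, N0, N'.
    by exists V, r, (M0 j), (M' j).
  case/ren_conjV=> [N0 [M0 [/(eq_posr e)[N' [M' [c n m]]] -> ->]]].
  exists (ren_neg r N'), (fun j => ren_neg r (M' j)).
  split=> [||j]; first exact: ren_conj.
    by exists V, r, N', N0.
  by exists V, r, (M' j), (M0 j).
case/eq_neg_inv: e => [[x -> ->]|[F [F' [-> -> h]]]]; first by left.
right; rewrite !ren_Sum; do 2!eexists; split=> // a.
by do 4!eexists; split; first exact: h.
Qed.

(** The common behaviour of renamings, substitutions and their composites on the positive layer, so
    that all the laws below share one coinduction. *)
Definition conjwise A V W (fp : pos A V -> pos A W) (fn : neg A V -> neg A W) :=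
  forall P, [/\ fp P = Omega <-> P = Omega,
    forall N a M, conjunct P (Cut N a M) ->
      conjunct (fp P) (Cut (fn N) a (fun j => fn (M j))) &
    forall N' a M', conjunct (fp P) (Cut N' a M') -> exists N M,
      [/\ conjunct P (Cut N a M), N' = fn N & M' = fun j => fn (M j)]].

Lemma conjwise_ren A V W (r : V -> W) :
  conjwise (@ren_pos A V W r) (ren_neg r).
Proof. by move=> P; split; [exact: ren_Omega|exact: ren_conj|exact: ren_conjV]. Qed.

Lemma conjwise_sub A V W (s : V -> neg A W) : conjwise (sub_pos s) (sub_neg s).
Proof. by move=> P; split; [exact: sub_Omega|exact: sub_conj|exact: sub_conjV]. Qed.

Lemma conjwise_id A V : conjwise (@id (pos A V)) id.
Proof. by move=> P; split=> // N a M c; exists N, M. Qed.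

Lemma conjwise_comp A U V W fp fn gp gn :
  @conjwise A V W fp fn -> @conjwise A U V gp gn -> conjwise (fp \o gp) (fn \o gn).
Proof.
move=> hf hg P; have [gO gc gV] := hg P; have [fO fc fV] := hf (gp P).
split=> [|N a M /gc/fc//|N a M /fV[N' [M' [/gV[N2 [M2 [c -> ->]]] -> ->]]]].
  by rewrite /= fO gO.
by exists N2, M2.
Qed.

(** Since [I] relates the maps themselves and not their values, a law of substitution only has to be
    checked on variables and under a binder. *)
Lemma map_coind A (I : forall V W, (pos A V -> pos A W) -> (neg A V -> neg A W) ->
    (pos A V -> pos A W) -> (neg A V -> neg A W) -> Prop) :
  (forall V W fp fn gp gn, I V W fp fn gp gn -> [/\ conjwise fp fn, conjwise gp gn,
     forall x, fn (Var x) =n gn (Var x) & forall F, exists fp' fn' gp' gn',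
       [/\ fn (Sum F) = Sum (fun a => fp' a (F a)),
           gn (Sum F) = Sum (fun a => gp' a (F a)) &
           forall a : A, I (V + 'I_(ar a))%type (W + 'I_(ar a))%type
                         (fp' a) (fn' a) (gp' a) (gn' a)]]) ->
  forall V W fp fn gp gn, I V W fp fn gp gn ->
    (forall P, fp P =p gp P) /\ (forall N, fn N =n gn N).
Proof.
move=> HI.
suff: (forall W P Q,
  (exists V fp fn gp gn P0, [/\ I V W fp fn gp gn, P = fp P0 & Q = gp P0]) -> P =p Q) /\
  (forall W P Q,
  (exists V fp fn gp gn N, [/\ I V W fp fn gp gn, P = fn N & Q = gn N]) -> P =n Q).
  move=> [h1 h2] V W fp fn gp gn hI; split=> [P|N].
    by apply: h1; exists V, fp, fn, gp, gn, P.
  by apply: h2; exists V, fp, fn, gp, gn, N.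
apply: eq_coind => W _ _ [V [fp [fn [gp [gn [P [hI -> ->]]]]]]];
  have [cf cg ev es] := HI _ _ _ _ _ _ hI.
  have [fO fc fV] := cf P; have [gO gc gV] := cg P.
  split=> [|N a M|N a M]; first by rewrite fO gO.
    case/fV=> [N0 [M0 [c -> ->]]].
    exists (gn N0), (fun j => gn (M0 j)); split; first exact: gc.
      by exists V, fp, fn, gp, gn, N0.
    by move=> j; exists V, fp, fn, gp, gn, (M0 j).
  case/gV=> [N0 [M0 [c -> ->]]].
  exists (fn N0), (fun j => fn (M0 j)); split; first exact: fc.
    by exists V, fp, fn, gp, gn, N0.
  by move=> j; exists V, fp, fn, gp, gn, (M0 j).
case: P => [x|F]; first by left.
have [fp' [fn' [gp' [gn' [-> -> h]]]]] := es F.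
right; do 2!eexists; split=> // a.
by exists (V + 'I_(ar a))%type, (fp' a), (fn' a), (gp' a), (gn' a), (F a).
Qed.

(** * Substitution *)

Lemma sub_eq A :
  (forall W (P Q : pos A W), (exists V (s : V -> neg A W) P0 Q0,
     [/\ P0 =p Q0, P = sub_pos s P0 & Q = sub_pos s Q0]) -> P =p Q) /\
  (forall W (N M : neg A W), (exists V (s : V -> neg A W) N0 M0,
     [/\ N0 =n M0, N = sub_neg s N0 & M = sub_neg s M0]) -> N =n M).
Proof.
apply: eq_coind => W _ _ [V [s [P [Q [e -> ->]]]]].
  split=> [|N a M|N a M]; first by rewrite !sub_Omega (eq_posO e).
    case/sub_conjV=> [N0 [M0 [/(eq_posl e)[N' [M' [c n m]]] -> ->]]].
    exists (sub_neg s N'), (fun j => sub_neg s (M' j)).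
    split=> [||j]; first exact: sub_conj.
      by exists V, s, N0, N'.
    by exists V, s, (M0 j), (M' j).
  case/sub_conjV=> [N0 [M0 [/(eq_posr e)[N' [M' [c n m]]] -> ->]]].
  exists (sub_neg s N'), (fun j => sub_neg s (M' j)).
  split=> [||j]; first exact: sub_conj.
    by exists V, s, N', N0.
  by exists V, s, (M' j), (M0 j).
case/eq_neg_inv: e => [[x -> ->]|[F [F' [-> -> h]]]]; first by left.
right; rewrite !sub_Sum; do 2!eexists; split=> // a.
by do 4!eexists; split; first exact: h.
Qed.

Lemma ren_neg_eq A V W (r : V -> W) (P Q : neg A V) : P =n Q -> ren_neg r P =n ren_neg r Q.
Proof. by move=> e; apply: (ren_eq A).2; exists V, r, P, Q. Qed.

Lemma sub_ext A :
  (forall W (P Q : pos A W), (exists V (s t : V -> neg A W) P0,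
     [/\ forall x, fv_pos x P0 -> s x =n t x, P = sub_pos s P0 & Q = sub_pos t P0])
     -> P =p Q) /\
  (forall W (N M : neg A W), (exists V (s t : V -> neg A W) N0,
     [/\ forall x, fv_neg x N0 -> s x =n t x, N = sub_neg s N0 & M = sub_neg t N0])
     -> N =n M).
Proof.
apply: eq_coind => W _ _ [V [s [t [P [e -> ->]]]]].
  split=> [|N a M|N a M]; first by rewrite !sub_Omega.
    case/sub_conjV=> [N0 [M0 [c -> ->]]].
    exists (sub_neg t N0), (fun j => sub_neg t (M0 j)).
    split=> [||j]; first exact: sub_conj.
      exists V, s, t, N0; split=> // x fx; apply: e; exact: Fv_conj c (Fv_head _ fx).
    exists V, s, t, (M0 j); split=> // x fx; apply: e; exact: Fv_conj c (Fv_arg _ fx).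
  case/sub_conjV=> [N0 [M0 [c -> ->]]].
  exists (sub_neg s N0), (fun j => sub_neg s (M0 j)).
  split=> [||j]; first exact: sub_conj.
    exists V, s, t, N0; split=> // x fx; apply: e; exact: Fv_conj c (Fv_head _ fx).
  exists V, s, t, (M0 j); split=> // x fx; apply: e; exact: Fv_conj c (Fv_arg _ fx).
case: P e => [x|F] e; first by left; rewrite !sub_Var; apply: e; constructor.
right; rewrite !sub_Sum; do 2!eexists; split=> // a.
do 4!eexists; split; [|by []|by []] => -[x|j] //= fx.
by apply: ren_neg_eq; apply: e; exact: Fv_Sum fx.
Qed.

Lemma sub_pos_ext A V W (s t : V -> neg A W) (P : pos A V) :
  (forall x, fv_pos x P -> s x =n t x) -> sub_pos s P =p sub_pos t P.
Proof. by move=> e; apply: (sub_ext A).1; exists V, s, t, P. Qed.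
Lemma sub_neg_ext A V W (s t : V -> neg A W) (N : neg A V) :
  (forall x, fv_neg x N -> s x =n t x) -> sub_neg s N =n sub_neg t N.
Proof. by move=> e; apply: (sub_ext A).2; exists V, s, t, N. Qed.

Lemma sub_pos_eq A V W (s t : V -> neg A W) (P Q : pos A V) :
  P =p Q -> (forall x, s x =n t x) -> sub_pos s P =p sub_pos t Q.
Proof.
move=> e h; apply: (eqp_trans (Q := sub_pos s Q)); last exact: sub_pos_ext.
by apply: (sub_eq A).1; exists V, s, P, Q.
Qed.
Lemma sub_id A V (s : V -> neg A V) : (forall x, s x =n Var x) ->
  (forall P, sub_pos s P =p P) /\ (forall N, sub_neg s N =n N).
Proof.
(* The identity needs equal source and target scopes, while [I] is indexed by two arbitrary ones:
   hence the transport along [e]. *)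
pose I V W (fp : pos A V -> pos A W) (fn : neg A V -> neg A W) gp gn :=
  exists (e : V = W) (s : V -> neg A W),
  [/\ forall x, s x =n Var (eq_rect _ id x _ e), fp = sub_pos s, fn = sub_neg s,
      gp = eq_rect _ (fun W => pos A V -> pos A W) id _ e &
      gn = eq_rect _ (fun W => neg A V -> neg A W) id _ e].
move=> hs; apply: (@map_coind A I _ V V (sub_pos s) (sub_neg s) id id); last by exists erefl, s.
move=> {hs s V}V W fp fn gp gn [e].
case: W / e fp fn gp gn => fp fn gp gn [s [/= hs -> -> -> ->]].
split; [exact: conjwise_sub | exact: conjwise_id | by move=> x; rewrite sub_Var |].
move=> F; exists (fun a => sub_pos (lift_sub s)), (fun a => sub_neg (lift_sub s)).
exists (fun _ => id), (fun _ => id); rewrite sub_Sum; split=> // a.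
exists erefl, (lift_sub s); split=> // -[x|j] //=.
by apply: eqn_trans (ren_neg_eq _ (hs x)) _; rewrite ren_Var.
Qed.

Lemma ren_as_sub A V W (r : V -> W) :
  (forall P : pos A V, ren_pos r P =p sub_pos (fun x => Var (r x)) P) /\
  (forall N : neg A V, ren_neg r N =n sub_neg (fun x => Var (r x)) N).
Proof.
pose I V W (fp : pos A V -> pos A W) (fn : neg A V -> neg A W) gp gn :=
  exists (r : V -> W) (s : V -> neg A W),
  [/\ forall x, s x =n Var (r x), fp = ren_pos r, fn = ren_neg r,
      gp = sub_pos s & gn = sub_neg s].
apply: (@map_coind A I); last by exists r, (fun x => Var (r x)).
move=> {r V W}V W fp fn gp gn [r [s [hs -> -> -> ->]]].
split; [exact: conjwise_ren | exact: conjwise_sub | |].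
  by move=> x; rewrite sub_Var ren_Var; apply: eqn_sym.
move=> F; exists (fun a => ren_pos (lift_ren r)), (fun a => ren_neg (lift_ren r)).
exists (fun a => sub_pos (lift_sub s)), (fun a => sub_neg (lift_sub s)).
rewrite sub_Sum ren_Sum; split=> // a.
exists (lift_ren r), (lift_sub s); split=> // -[x|j] //=.
by apply: eqn_trans (ren_neg_eq _ (hs x)) _; rewrite ren_Var.
Qed.

Lemma sub_ren A U V W (r : U -> V) (s : V -> neg A W) :
  (forall P, sub_pos s (ren_pos r P) =p sub_pos (s \o r) P) /\
  (forall N, sub_neg s (ren_neg r N) =n sub_neg (s \o r) N).
Proof.
pose I U W (fp : pos A U -> pos A W) (fn : neg A U -> neg A W) gp gn :=
  exists V (r : U -> V) (s : V -> neg A W) (t : U -> neg A W),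
  [/\ forall x, s (r x) =n t x, fp = sub_pos s \o ren_pos r,
      fn = sub_neg s \o ren_neg r, gp = sub_pos t & gn = sub_neg t].
apply: (@map_coind A I _ U W (sub_pos s \o ren_pos r) (sub_neg s \o ren_neg r)
  (sub_pos (s \o r)) (sub_neg (s \o r))); last first.
  by exists V, r, s, (s \o r).
move=> {r s U V W}U W fp fn gp gn [V [r [s [t [h -> -> -> ->]]]]].
split.
- exact: conjwise_comp (conjwise_sub _) (conjwise_ren _).
- exact: conjwise_sub.
- by move=> x; rewrite /= sub_Var ren_Var sub_Var.
move=> F; exists (fun a => sub_pos (lift_sub s) \o ren_pos (lift_ren r)).
exists (fun a => sub_neg (lift_sub s) \o ren_neg (lift_ren r)).
exists (fun a => sub_pos (lift_sub t)), (fun a => sub_neg (lift_sub t)).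
rewrite /= ren_Sum !sub_Sum; split=> // a.
exists (V + 'I_(ar a))%type, (lift_ren r), (lift_sub s), (lift_sub t); split=> // -[x|j] //=.
exact: ren_neg_eq.
Qed.

Lemma ren_ren A U V W (r : U -> V) (q : V -> W) (N : neg A U) :
  ren_neg q (ren_neg r N) =n ren_neg (q \o r) N.
Proof.
apply: eqn_trans ((ren_as_sub A q).2 _) _.
apply: eqn_trans ((sub_ren _ _).2 _) _.
exact: eqn_sym ((ren_as_sub A _).2 _).
Qed.

Lemma ren_sub A U V W (s : U -> neg A V) (r : V -> W) :
  (forall P, ren_pos r (sub_pos s P) =p sub_pos (ren_neg r \o s) P) /\
  (forall N, ren_neg r (sub_neg s N) =n sub_neg (ren_neg r \o s) N).
Proof.
pose I U W (fp : pos A U -> pos A W) (fn : neg A U -> neg A W) gp gn :=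
  exists V (r : V -> W) (s : U -> neg A V) (t : U -> neg A W),
  [/\ forall x, ren_neg r (s x) =n t x, fp = ren_pos r \o sub_pos s,
      fn = ren_neg r \o sub_neg s, gp = sub_pos t & gn = sub_neg t].
apply: (@map_coind A I _ U W (ren_pos r \o sub_pos s) (ren_neg r \o sub_neg s)
  (sub_pos (ren_neg r \o s)) (sub_neg (ren_neg r \o s))); last first.
  by exists V, r, s, (ren_neg r \o s).
move=> {r s U V W}U W fp fn gp gn [V [r [s [t [h -> -> -> ->]]]]].
split.
- exact: conjwise_comp (conjwise_ren _) (conjwise_sub _).
- exact: conjwise_sub.
- by move=> x; rewrite /= !sub_Var.
move=> F; exists (fun a => ren_pos (lift_ren r) \o sub_pos (lift_sub s)).
exists (fun a => ren_neg (lift_ren r) \o sub_neg (lift_sub s)).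
exists (fun a => sub_pos (lift_sub t)), (fun a => sub_neg (lift_sub t)).
rewrite /= !sub_Sum ren_Sum; split=> // a.
exists (V + 'I_(ar a))%type, (lift_ren r), (lift_sub s), (lift_sub t); split=> // -[x|j] /=.
  apply: eqn_trans (ren_ren _ _ _) _.
  apply: eqn_trans _ (ren_neg_eq _ (h x)).
  exact: eqn_sym (ren_ren r inl (s x)).
by rewrite ren_Var.
Qed.

Lemma sub_sub A U V W (s : U -> neg A V) (t : V -> neg A W) :
  (forall P, sub_pos t (sub_pos s P) =p sub_pos (sub_neg t \o s) P) /\
  (forall N, sub_neg t (sub_neg s N) =n sub_neg (sub_neg t \o s) N).
Proof.
pose I U W (fp : pos A U -> pos A W) (fn : neg A U -> neg A W) gp gn :=
  exists V (t : V -> neg A W) (s : U -> neg A V) (u : U -> neg A W),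
  [/\ forall x, sub_neg t (s x) =n u x, fp = sub_pos t \o sub_pos s,
      fn = sub_neg t \o sub_neg s, gp = sub_pos u & gn = sub_neg u].
apply: (@map_coind A I _ U W (sub_pos t \o sub_pos s) (sub_neg t \o sub_neg s)
  (sub_pos (sub_neg t \o s)) (sub_neg (sub_neg t \o s))); last first.
  by exists V, t, s, (sub_neg t \o s).
move=> {t s U V W}U W fp fn gp gn [V [t [s [u [h -> -> -> ->]]]]].
split.
- exact: conjwise_comp (conjwise_sub _) (conjwise_sub _).
- exact: conjwise_sub.
- by move=> x; rewrite /= !sub_Var.
move=> F; exists (fun a => sub_pos (lift_sub t) \o sub_pos (lift_sub s)).
exists (fun a => sub_neg (lift_sub t) \o sub_neg (lift_sub s)).
exists (fun a => sub_pos (lift_sub u)), (fun a => sub_neg (lift_sub u)).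
rewrite /= !sub_Sum; split=> // a.
exists (V + 'I_(ar a))%type, (lift_sub t), (lift_sub s), (lift_sub u); split=> // -[x|j] /=.
  apply: eqn_trans ((sub_ren _ _).2 _) _.
  apply: eqn_trans _ (ren_neg_eq _ (h x)).
  exact: eqn_sym ((ren_sub _ _).2 _).
by rewrite sub_Var.
Qed.

Definition cat_sub A U V m (s : U -> neg A V) (M : 'I_m -> neg A V) (v : U + 'I_m) :=
  match v with inl x => s x | inr j => M j end.

(** With [inst_sub], this makes reduction commute with substitution: firing a cut after or before
    substituting amounts to one and the same simultaneous substitution [cat_sub]. *)
Lemma sub_inst A U V m (s : U -> neg A V) (M : 'I_m -> neg A V) P :
  sub_pos (inst M) (sub_pos (lift_sub s) P) =p sub_pos (cat_sub s M) P.
Proof.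
apply: eqp_trans ((sub_sub _ _).1 _) _.
apply: sub_pos_ext => -[x|j] _ /=; last by rewrite sub_Var.
apply: eqn_trans ((sub_ren _ _).2 _) _.
by apply: (sub_id _).2.
Qed.

Lemma inst_sub A U V m (s : U -> neg A V) (M : 'I_m -> neg A U) P :
  sub_pos s (sub_pos (inst M) P) =p sub_pos (cat_sub s (fun j => sub_neg s (M j))) P.
Proof.
apply: eqp_trans ((sub_sub _ _).1 _) _.
by apply: sub_pos_ext => -[x|j] _ //=; rewrite sub_Var.
Qed.

(** * Convergence and normal forms *)

Inductive conv A V (P : pos A V) : Prop :=
| Conv of P <> Omega & (forall x a M, ~ conjunct P (Cut (Var x) a M)) &
    (forall Q, red P Q -> conv Q).

Definition conv_cut A V (N : neg A V) a M :=
  exists2 F, N = Sum F & conv (sub_pos (inst M) (F a)).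

Lemma red_Cut A V (P : pos A V) F a M :
  conjunct P (Cut (Sum F) a M) -> red P (sub_pos (inst M) (F a)).
Proof. by move=> c; exists F, a, M. Qed.

Lemma conv_conj A V (P : pos A V) N a M :
  conv P -> conjunct P (Cut N a M) -> conv_cut N M.
Proof.
case=> _ hv hr; case: N => [x|F] c; first by case: (hv _ _ _ c).
by exists F; [|exact: hr (red_Cut c)].
Qed.

Lemma conv_intro A V (P : pos A V) : P <> Omega ->
  (forall N a M, conjunct P (Cut N a M) -> conv_cut N M) -> conv P.
Proof.
move=> nO h; split; first exact: nO; first by move=> x a M /h[F].
by move=> _ [F [b [M [/h[F' [<-] c] ->]]]].
Qed.

Lemma eq_inst A V m (M M' : 'I_m -> neg A V) v :
  (forall j, M j =n M' j) -> inst M v =n inst M' v.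
Proof. by case: v => //=. Qed.

Lemma conv_eq A V (P Q : pos A V) : conv P -> P =p Q -> conv Q.
Proof.
move=> cP; elim: cP Q => {}P nO hv hr IH Q e; apply: conv_intro.
  by rewrite -(eq_posO e).
move=> N a M /(eq_posr e)[[x|F] [M0 [c n m]]]; first by case: (hv _ _ _ c).
case/eq_neg_Sum: n => F' -> h; exists F'; first by [].
apply: IH (red_Cut c) _ _; apply: sub_pos_eq => // v; exact: eq_inst.
Qed.

Lemma conv_cut_eq A V (N N' : neg A V) a (M M' : 'I_(ar a) -> neg A V) :
  conv_cut N M -> N =n N' -> (forall j, M j =n M' j) -> conv_cut N' M'.
Proof.
case=> F -> cF /eq_neg_Sum[F' -> h] m; exists F'; first by [].
apply: conv_eq cF _; apply: sub_pos_eq => // v; exact: eq_inst.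
Qed.

Lemma conv_single A V (N : neg A V) a M : conv (single (Cut N a M)) <-> conv_cut N M.
Proof.
split=> [c|c]; first by apply: conv_conj c _; exists tt.
apply: conv_intro; first by [].
suff h T : conjunct (single (Cut N a M)) T ->
    match T with Cut N a M => conv_cut N M end by move=> N' b M' /h.
by case=> _ <-.
Qed.

Lemma conv_reds A V (P Q : pos A V) : conv P -> reds P Q -> conv Q.
Proof.
by move=> + r; elim: r => [|{}P R {}Q r _ IH [_ _ h]]; [|exact/IH/h].
Qed.

(** Convergence without the condition on head variables, hence meaningful for open designs. *)
Inductive normalizing A V (P : pos A V) : Prop :=
| Normalizing of P <> Omega & (forall Q, red P Q -> normalizing Q).

Lemma normalizing_reds A V (P Q : pos A V) :
  normalizing P -> reds P Q -> normalizing Q.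
Proof.
by move=> + r; elim: r => [|{}P R {}Q r _ IH [_ h]]; [|exact/IH/h].
Qed.

Lemma normalizingP A V (P : pos A V) : normalizing P <-> ~ diverges P.
Proof.
split=> [nP [[f [f0 fr]]|]|dP].
- elim: nP f f0 fr => {}P _ _ IH f f0 fr.
  have r : red P (f 1) by rewrite -f0.
  exact: IH r (fun n => f n.+1) erefl (fun n => fr n.+1).
- by move/(normalizing_reds nP) => -[].
apply: contrapT => nP.
(* Reachability from [P] is kept in the type, so that meeting [Omega] already makes [P] diverge;
   otherwise a reduct that fails to normalize exists, and choice builds an infinite reduction. *)
have step (s : {Q | reds P Q /\ ~ normalizing Q}) :
    exists t : {Q | reds P Q /\ ~ normalizing Q}, red (projT1 s) (projT1 t).
  case: s => Q [PQ nQ] /=; apply: contrapT => nt.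
  apply: nQ; split=> [QO|R QR]; first by apply: dP; right; rewrite -QO.
  apply: contrapT => nR; apply: nt.
  have PR : reds P R.
    elim: PQ QR => [Q' r|P1 P2 P3 r _ IH /IH]; last exact: rt1n_trans.
    exact: rt1n_trans r (rt1n_refl _ _ _).
  by exists (exist _ R (conj PR nR)).
have [g hg] := choice step.
pose s0 : {Q | reds P Q /\ ~ normalizing Q} :=
  exist _ P (conj (rt1n_refl _ _ _) nP).
by apply: dP; left; exists (fun n => projT1 (iter n g s0)); split=> // n /=.
Qed.

Lemma nf_conj A V (P Q : pos A V) x a M : normalizing P -> reds P Q ->
  conjunct Q (Cut (Var x) a M) ->
  conjunct (nf_pos P) (Cut (Var x) a (fun j => nf_neg (M j))).
Proof.
move=> /normalizingP nP r c; apply/(nf_conjunct nP).2.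
by exists Q, x, a, M.
Qed.

Lemma nf_conjV A V (P : pos A V) N a M : conjunct (nf_pos P) (Cut N a M) ->
  exists Q x L, [/\ reds P Q, conjunct Q (Cut (Var x) a L), N = Var x &
                    M = fun j => nf_neg (L j)].
Proof.
case: (pselect (diverges P)) => [/nf_diverges-> //|nP].
pose rel (S : pre A V) := match S with Cut N a M =>
  exists Q x L, [/\ reds P Q, conjunct Q (Cut (Var x) a L), N = Var x &
                    M = fun j => nf_neg (L j)] end.
suff h S : conjunct (nf_pos P) S -> rel S by apply: h.
by case/(nf_conjunct nP).2=> [Q [x [b [L [r c ->]]]]] /=; exists Q, x, L.
Qed.

Lemma nf_Omega A V (P : pos A V) : nf_pos P <> Omega <-> normalizing P.
Proof.
split=> [h|/normalizingP/nf_conjunct[]//].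
by apply/normalizingP => /nf_diverges.
Qed.

Lemma nf_Sum A V F : nf_neg (Sum F : neg A V) = Sum (fun a => nf_pos (F a)).
Proof. by rewrite [LHS]unfold_negE. Qed.
Lemma nf_Var A V (x : V) : nf_neg (Var x : neg A V) = Var x.
Proof. by rewrite [LHS]unfold_negE. Qed.

(** The conjuncts of the normal form are the head-variable conjuncts of all the reducts: there are
    none exactly when no reduct shows a head variable, and the normal form differs from [Omega]
    exactly when [P] normalizes. *)
Lemma convP A V (P : pos A V) : nf_pos P =p daimon <-> conv P.
Proof.
split=> [e|cP].
  have nP : normalizing P by apply/nf_Omega; rewrite (eq_posO e).
  have hv Q x a M : reds P Q -> ~ conjunct Q (Cut (Var x) a M).
    by move=> r c; have [N [? [[]]]] := eq_posl e (nf_conj nP r c).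
  elim: nP hv {e} => {}P nO _ IH hv; split; first exact: nO.
    by move=> x a M; apply: hv; exact: rt1n_refl.
  by move=> Q r; apply: (IH _ r) => R x a M r'; apply: hv; exact: rt1n_trans r r'.
have nP : normalizing P by elim: cP => {}P nO _ _; exact: Normalizing.
split=> [|[N a M]|T []//]; first by split=> // /(nf_Omega P).2.
by case/nf_conjV=> [Q [x [L [/(conv_reds cP)[_ h _] /h]]]].
Qed.

Lemma eq_conv A V (P Q : pos A V) : P =p Q -> conv P <-> conv Q.
Proof. by move=> e; split=> c; apply: conv_eq c _ => //; apply: eqp_sym. Qed.

(** [nf_ctx N N'] holds when [N'] is obtained from [N], read as an iterated
    closure, by normalizing some of the designs of the closure. *)
Inductive nf_ctx A V : neg A V -> neg A V -> Prop :=
| Nf_var x : nf_ctx (Var x) (Var x)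
| Nf_sub W (N0 : neg A W) s s' N N' of
    N =n sub_neg s N0 &
    N' =n sub_neg s' N0 \/ N' =n sub_neg s' (nf_neg N0) &
    (forall w, nf_ctx (s w) (s' w)) : nf_ctx N N'.

Definition nf_ctx_pos A V (P P' : pos A V) : Prop :=
  exists W (P0 : pos A W) s s',
    [/\ forall w, nf_ctx (s w) (s' w), P =p sub_pos s P0 &
        P' =p sub_pos s' P0 \/ P' =p sub_pos s' (nf_pos P0)].

Lemma nf_ctx_pos_eq A V (P P' Q Q' : pos A V) :
  nf_ctx_pos P P' -> Q =p P -> Q' =p P' -> nf_ctx_pos Q Q'.
Proof.
move=> [W [P0 [s [s' [h e e']]]]] eQ eQ'; exists W, P0, s, s'; split=> //.
  exact: eqp_trans e.
by case: e' => e'; [left|right]; apply: eqp_trans e'.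
Qed.

(** The relation survives the firing of a cut. The closure in head position is followed until a sum
    appears; the arguments then join its closure through [cat_sub], which is why [nf_ctx] allows an
    arbitrary intermediate scope. *)
Lemma nf_ctx_cut A V (N N' : neg A V) a (M M' : 'I_(ar a) -> neg A V) :
  nf_ctx N N' -> (forall j, nf_ctx (M j) (M' j)) ->
  (exists2 x, N = Var x & N' = Var x) \/
  exists F F', [/\ N = Sum F, N' = Sum F' &
    nf_ctx_pos (sub_pos (inst M) (F a)) (sub_pos (inst M') (F' a))].
Proof.
move=> nN nM; elim: nN => {N N'} [x|W N0 s s' N N' e e' h IH].
  by left; exists x.
case: N0 e e' => [w|G].
  rewrite nf_Var !sub_Var => e e'.
  have {}e' : N' =n s' w by case: e'.
  case: (IH w) => [[x sx sx']|[F [F' [sF sF' hF]]]].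
    rewrite sx in e; rewrite sx' in e'.
    by left; exists x; apply: eq_neg_Var; apply: eqn_sym.
  move: e e'; rewrite sF sF' => /eqn_sym/eq_neg_Sum[F1 -> h1].
  move=> /eqn_sym/eq_neg_Sum[F1' -> h1']; right; exists F1, F1'; split=> //.
  by apply: nf_ctx_pos_eq hF _ _; apply: sub_pos_eq => //; apply: eqp_sym.
rewrite nf_Sum !sub_Sum => /eqn_sym/eq_neg_Sum[F -> hF] e'; right.
have [F' EF' hF'] : exists2 F', N' = Sum F' &
    F' a =p sub_pos (lift_sub s') (G a) \/
    F' a =p sub_pos (lift_sub s') (nf_pos (G a)).
  case: e' => /eqn_sym/eq_neg_Sum[F' -> hF']; exists F' => //.
    by left; apply: eqp_sym.
  by right; apply: eqp_sym.
exists F, F'; split=> //.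
exists (W + 'I_(ar a))%type, (G a), (cat_sub s M), (cat_sub s' M'); split.
- by case.
- apply: eqp_trans _ (sub_inst _ _ _).
  by apply: sub_pos_eq => //; apply: eqp_sym.
- by case: hF' => hF'; [left|right]; apply: eqp_trans _ (sub_inst _ _ _);
    apply: sub_pos_eq.
Qed.

Lemma red_sub A V W (s : V -> neg A W) (P P' : pos A V) Q :
  red P P' -> Q =p sub_pos s P -> exists2 Q', red Q Q' & Q' =p sub_pos s P'.
Proof.
move=> [F [b [M [/(sub_conj s) c ->]]]] e.
have [N [M' [cQ n m]]] := eq_posr e c.
move: n; rewrite sub_Sum => /eqn_sym/eq_neg_Sum[F' EN hF]; subst N.
exists (sub_pos (inst M') (F' b)); first exact: red_Cut.
apply: eqp_trans _ (eqp_sym (inst_sub _ _ _)).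
apply: eqp_trans _ (sub_inst _ _ _).
by apply: sub_pos_eq => [|v]; [apply: eqp_sym | exact: eq_inst].
Qed.

(** Every reduction of [P] is simulated by one of its closure, so termination of the closure
    transfers to [P]. *)
Lemma conv_normalizing A V W (s : V -> neg A W) (P : pos A V) Q :
  conv Q -> Q =p sub_pos s P -> normalizing P.
Proof.
move=> cQ; elim: cQ P => {}Q nO _ _ IH P e; split=> [PO|P' r].
  by apply: nO; rewrite (eq_posO e) PO sub_Omega.
by have [Q' rQ eQ] := red_sub r e; apply: IH rQ _ eQ.
Qed.

(** When the outer layer [P0] has been normalized, a conjunct of its normal form comes from a reduct
    of [P0]. If no reduction was made, it matches a conjunct of [P] itself. Otherwise the first
    reduction is simulated in [P], and the induction hypothesis applies to the closures of the first
    reduct and of its normal form, where the conjunct is still present. *)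
Lemma nf_ctx_conv A V (P P' : pos A V) : nf_ctx_pos P P' -> conv P -> conv P'.
Proof.
move=> h cP; elim: cP P' h => {}P nO hv hr IH P' [W [P0 [s [s' [hs e e']]]]].
have cut N a M N' M' : conjunct P (Cut N a M) -> nf_ctx N N' ->
    (forall j, nf_ctx (M j) (M' j)) -> conv_cut N' M'.
  move=> c nN nM; case: (nf_ctx_cut nN nM) => [[x Nx _]|[F [F' [NF -> hF]]]].
    by subst N; case: (hv _ _ _ c).
  by subst N; exists F'; [by [] | apply: IH hF]; exact: red_Cut.
case: e' => e'.
  apply: conv_intro => [P'O|N' a M'].
    by apply: nO; rewrite (eq_posO e) sub_Omega -(sub_Omega s') -(eq_posO e').
  case/(eq_posl e') => [_ [_ [/sub_conjV[N0 [M0 [c -> ->]]] n m]]].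
  have [N [M [cP n' m']]] := eq_posr e (sub_conj s c).
  apply: cut cP _ _ => [|j]; first by apply: (Nf_sub n') => //; left.
  by apply: (Nf_sub (m' j)) => //; left.
have nP0 : normalizing P0.
  by apply: conv_normalizing e; split.
apply: conv_intro => [P'O|N' a M'].
  by have /nf_Omega := nP0; apply; rewrite -(sub_Omega s') -(eq_posO e').
case/(eq_posl e') => [_ [_ [/sub_conjV[N0 [M0 [c -> ->]]] n m]]].
case/nf_conjV: c n m => [Q [x [L [r c -> ->]]]] n m.
apply: conv_cut_eq; [|exact: eqn_sym n|by move=> j; exact: eqn_sym (m j)].
case: r c => [|P1 Q1 r rQ] c.
  have [N [M [cP n' m']]] := eq_posr e (sub_conj s c).
  apply: cut cP _ _ => [|j]; first by apply: (Nf_sub n') => //; left.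
  by apply: (Nf_sub (m' j)) => //; right.
have [Q' rP eQ'] := red_sub r e.
have cn : conv (sub_pos s' (nf_pos P1)).
  by apply: IH rP _ _; exists W, P1, s, s'; split=> //; right.
have nP1 : normalizing P1 by case: nP0 => _; apply.
exact: conv_conj cn (sub_conj s' (nf_conj nP1 rQ c)).
Qed.

(** Reductions inside a normalized layer have no counterpart in [P'], so the induction on [conv P']
    does not see them. They terminate, because the normal form of that layer is not [Omega]. *)
Lemma nf_ctx_convV A V (P P' : pos A V) : nf_ctx_pos P P' -> conv P' -> conv P.
Proof.
move=> h cP; elim: cP P h => {}P' nO hv hr IH P [W [P0 [s [s' [hs e e']]]]].
have cut N a M N' M' : conjunct P' (Cut N' a M') -> nf_ctx N N' ->
    (forall j, nf_ctx (M j) (M' j)) -> conv_cut N M.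
  move=> c nN nM; case: (nf_ctx_cut nN nM) => [[x _ Nx]|[F [F' [-> NF hF]]]].
    by subst N'; case: (hv _ _ _ c).
  by subst N'; exists F; [by [] | apply: IH hF]; exact: red_Cut.
case: e' => e'.
  apply: conv_intro => [PO|N a M].
    by apply: nO; rewrite (eq_posO e') sub_Omega -(sub_Omega s) -(eq_posO e).
  case/(eq_posl e) => [_ [_ [/sub_conjV[N0 [M0 [c -> ->]]] n m]]].
  have [N' [M' [cP n' m']]] := eq_posr e' (sub_conj s' c).
  apply: cut cP _ _ => [|j]; first by apply: (Nf_sub n) => //; left.
  by apply: (Nf_sub (m j)) => //; left.
have nP0 : normalizing P0.
  by apply/nf_Omega; rewrite -(sub_Omega s') -(eq_posO e').
(* Inner induction on the reducts of [P0]: a conjunct with a sum in head position is an internal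
   step, while one with a head variable survives in the normal form and is treated by the outer
   induction. *)
suff: forall P1, normalizing P1 -> reds P0 P1 ->
    forall Q, Q =p sub_pos s P1 -> conv Q.
  by move=> h; apply: (h _ nP0 _ _ e); exact: rt1n_refl.
move=> P1 nP1; elim: nP1 => {}P1 P1O _ IH1 r1 Q eQ.
apply: conv_intro => [QO|N a M].
  by apply: P1O; rewrite -(sub_Omega s) -(eq_posO eQ).
move=> cQ; case: (eq_posl eQ cQ) => [_ [_ [/sub_conjV[N0 [L [c -> ->]]] n m]]].
case: N0 c n => [x|G] c n.
  have [N' [M' [cP n' m']]] := eq_posr e' (sub_conj s' (nf_conj nP0 r1 c)).
  apply: cut cP _ _ => [|j]; first by apply: (Nf_sub n) => //; left.
  by apply: (Nf_sub (m j)) => //; right.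
move: (n); rewrite sub_Sum => /eqn_sym/eq_neg_Sum[F EN hF]; subst N.
have r : red P1 (sub_pos (inst L) (G a)) by exact: red_Cut.
exists F; first by [].
apply: (IH1 _ r).
  elim: r1 r {c IH1 eQ} => [R r|R R1 R2 rR _ IH' /IH']; last exact: rt1n_trans.
  exact: rt1n_trans r (rt1n_refl _ _ _).
apply: eqp_trans _ (eqp_sym (inst_sub _ _ _)).
apply: eqp_trans _ (sub_inst _ _ _).
by apply: sub_pos_eq => [|v]; [apply: eqp_sym | exact: eq_inst].
Qed.

(** * Free variables, standard designs, proofs *)

Lemma Fv_args A V (x : V) (P : pos A V) N a M j :
  conjunct P (Cut N a M) -> fv_neg x (M j) -> fv_pos x P.
Proof. by move=> c f; apply: Fv_conj c _; exact: Fv_arg f. Qed.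
Lemma Fv_heads A V (x : V) (P : pos A V) N a M :
  conjunct P (Cut N a M) -> fv_neg x N -> fv_pos x P.
Proof. by move=> c f; apply: Fv_conj c _; exact: Fv_head. Qed.

Scheme fv_pos_min := Minimality for fv_pos Sort Prop
with fv_pre_min := Minimality for fv_pre Sort Prop
with fv_neg_min := Minimality for fv_neg Sort Prop.

(** Removes predesigns from the mutual induction: the property attached to a predesign is that of
    all the positive designs having it as a conjunct. *)
Lemma fv_ind A (Cp : forall V, V -> pos A V -> Prop) (Cn : forall V, V -> neg A V -> Prop) :
  (forall V x P N a M, conjunct P (Cut N a M) -> Cn V x N -> Cp V x P) ->
  (forall V x P N a (M : 'I_(ar a) -> neg A V) j, conjunct P (Cut N a M) ->
     Cn V x (M j) -> Cp V x P) ->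
  (forall V x, Cn V x (Var x)) ->
  (forall V x F a, fv_pos (inl x) (F a) ->
     Cp (V + 'I_(ar a))%type (inl x) (F a) -> Cn V x (Sum F)) ->
  (forall V x P, fv_pos x P -> Cp V x P) /\ (forall V x N, fv_neg x N -> Cn V x N).
Proof.
move=> h1 h2 h3 h4.
pose Cs V x (S : pre A V) := forall P, conjunct P S -> Cp V x P.
have h5 V x N a M : fv_neg x N -> Cn V x N -> Cs V x (Cut N a M).
  by move=> _ h P c; exact: h1 c h.
have h6 V x N a (M : 'I_(ar a) -> neg A V) j :
    fv_neg x (M j) -> Cn V x (M j) -> Cs V x (Cut N a M).
  by move=> _ h P c; exact: h2 c h.
have h7 V x P S : conjunct P S -> fv_pre x S -> Cs V x S -> Cp V x P.
  by move=> c _; apply.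
by split=> V x D; [apply: (fv_pos_min h7 h5 h6 h3 h4)
                  | apply: (fv_neg_min h7 h5 h6 h3 h4)].
Qed.

Lemma fv_eq A :
  (forall V (x : V) (P : pos A V), fv_pos x P -> forall Q, P =p Q -> fv_pos x Q) /\
  (forall V (x : V) (N : neg A V), fv_neg x N -> forall N', N =n N' -> fv_neg x N').
Proof.
apply: fv_ind => [V x P N a M c IH Q e|V x P N a M j c IH Q e|V x N|V x F a _ IH N].
- have [N' [M' [c' n m]]] := eq_posl e c; exact: Fv_heads c' (IH _ n).
- have [N' [M' [c' n m]]] := eq_posl e c; exact: Fv_args c' (IH _ (m j)).
- by move=> e; rewrite (eq_neg_Var e); constructor.
- by case/eq_neg_Sum=> F' -> h; apply: (Fv_Sum (a := a)); exact: IH (h a).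
Qed.

Lemma fv_ren A :
  (forall W (x : W) (P : pos A W), fv_pos x P -> forall V (r : V -> W) P0,
     P = ren_pos r P0 -> exists2 v, fv_pos v P0 & x = r v) /\
  (forall W (x : W) (N : neg A W), fv_neg x N -> forall V (r : V -> W) N0,
     N = ren_neg r N0 -> exists2 v, fv_neg v N0 & x = r v).
Proof.
apply: fv_ind => [W x P N a M c IH V r P0 e|W x P N a M j c IH V r P0 e
                 |W x V r N0|W x F a _ IH V r N0].
- subst P; have [N0 [M0 [c0 e _]]] := ren_conjV c.
  by have [v f ->] := IH _ _ _ e; exists v => //; exact: Fv_heads c0 f.
- subst P; have [N0 [M0 [c0 _ e]]] := ren_conjV c.
  have [v f ->] := IH _ _ (M0 j) (congr1 (fun f => f j) e).
  by exists v => //; exact: Fv_args c0 f.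
- case: N0 => [y|F]; rewrite ?ren_Var ?ren_Sum // => -[->].
  by exists y => //; constructor.
- case: N0 => [y|F0]; rewrite ?ren_Var ?ren_Sum // => -[FE].
  have [[v|j] f] := IH _ _ (F0 a) (congr1 (fun f => f a) FE); last by [].
  by case=> ->; exists v => //; exact: Fv_Sum f.
Qed.

Lemma fv_sub A :
  (forall W (x : W) (P : pos A W), fv_pos x P -> forall V (s : V -> neg A W) P0,
     P = sub_pos s P0 -> exists2 v, fv_pos v P0 & fv_neg x (s v)) /\
  (forall W (x : W) (N : neg A W), fv_neg x N -> forall V (s : V -> neg A W) N0,
     N = sub_neg s N0 -> exists2 v, fv_neg v N0 & fv_neg x (s v)).
Proof.
apply: fv_ind => [W x P N a M c IH V s P0 e|W x P N a M j c IH V s P0 e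
                 |W x V s N0|W x F a f IH V s N0].
- subst P; have [N0 [M0 [c0 e _]]] := sub_conjV c.
  by have [v f fs] := IH _ _ _ e; exists v => //; exact: Fv_heads c0 f.
- subst P; have [N0 [M0 [c0 _ e]]] := sub_conjV c.
  have [v f fs] := IH _ _ (M0 j) (congr1 (fun f => f j) e).
  by exists v => //; exact: Fv_args c0 f.
- case: N0 => [y|F]; rewrite ?sub_Var ?sub_Sum // => e.
  by exists y; [constructor | rewrite -e; constructor].
- case: N0 => [y|F0]; rewrite ?sub_Var ?sub_Sum.
  by move=> e; exists y; [constructor | rewrite -e; exact: Fv_Sum f].
case=> FE.
have [[v|j] {}f] := IH _ _ (F0 a) (congr1 (fun f => f a) FE); last first.
  by rewrite /= => g; inversion g.
move=> g; have [w fw [->]] := (fv_ren A).2 _ _ _ g _ _ _ erefl.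
by exists v => //; exact: Fv_Sum f.
Qed.

Lemma fv_red A V (P Q : pos A V) x : red P Q -> fv_pos x Q -> fv_pos x P.
Proof.
case=> F [b [M [c ->]]] h.
have [[v|j] f g] := (fv_sub A).1 _ _ _ h _ _ _ erefl.
  apply: Fv_heads c _; inversion g; exact: Fv_Sum f.
exact: Fv_args c g.
Qed.

Lemma fv_nf A :
  (forall V (x : V) (P : pos A V), fv_pos x P -> forall P0, P = nf_pos P0 -> fv_pos x P0) /\
  (forall V (x : V) (N : neg A V), fv_neg x N -> forall N0, N = nf_neg N0 -> fv_neg x N0).
Proof.
have fvr V (x : V) (P Q : pos A V) : reds P Q -> fv_pos x Q -> fv_pos x P.
  by elim=> // {}P R {}Q r _ IH /IH; exact: fv_red.
apply: fv_ind => [V x P N a M c IH P0 e|V x P N a M j c IH P0 e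
                 |V x N0|V x F a _ IH N0].
- subst P; have [Q [y [L [r c0 e _]]]] := nf_conjV c.
  apply: (fvr _ _ _ _ r); apply: (Fv_heads c0); apply: IH; by rewrite e nf_Var.
- subst P; have [Q [y [L [r c0 _ e]]]] := nf_conjV c.
  apply: (fvr _ _ _ _ r); apply: (Fv_args c0); apply: IH; by rewrite e.
- case: N0 => [y|F0]; rewrite ?nf_Var ?nf_Sum // => -[->]; constructor.
- case: N0 => [y|F0]; rewrite ?nf_Var ?nf_Sum // => -[e].
  apply: (Fv_Sum (a := a)); by apply: IH; rewrite e.
Qed.

(** * Standard designs and their preservation *)

Lemma std_coind A (Rp : forall V, pos A V -> Prop) (Rn : forall V, neg A V -> Prop) :
  (forall V P N a M, Rp V P -> conjunct P (Cut N a M) ->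
     (exists x, N = Var x) /\ forall j, Rn V (M j)) ->
  (forall V N, Rn V N -> exists2 F, N = Sum F & forall a, Rp _ (F a)) ->
  (forall V P, Rp V P -> std_pos P) /\ (forall V N, Rn V N -> std_neg N).
Proof.
move=> Hp Hn.
have Hp' V P : Rp V P -> forall S, conjunct P S ->
    match S with Cut N a M => (exists x, N = Var x) /\ forall j, Rn V (M j) end.
  by move=> r [N a M]; exact: Hp.
pose pre_of V (sn : forall N, Rn V N -> std_neg N) (S : pre A V) :=
  match S return match S with
    Cut N a M => (exists x, N = Var x) /\ forall j, Rn V (M j) end -> std_pre S with
  | Cut N a M => fun r => match r with conj (ex_intro x e) m =>
      match esym e in _ = N return std_pre (Cut N a M) with
      | erefl => @Std_pre A V x a M (fun j => sn _ (m j)) end end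
  end.
pose sp := cofix sp V P (r : Rp V P) : std_pos P :=
  Std_pos (fun S c => pre_of V (sn V) S (Hp' V P r S c))
with sn V N (r : Rn V N) : std_neg N :=
  match Hn V N r with
  | ex_intro2 F e h => match esym e in _ = N return std_neg N with
    | erefl => Std_neg (fun a => sp _ _ (h a)) end
  end for sp.
split; first exact: sp.
move=> V N /Hn[F -> h]; constructor => a; exact: sp.
Qed.

Lemma std_conj A V (P : pos A V) N a M : std_pos P -> conjunct P (Cut N a M) ->
  (exists x, N = Var x) /\ forall j, std_neg (M j).
Proof.
pose rel (S : pre A V) := match S with Cut N a M =>
  (exists x, N = Var x) /\ forall j, std_neg (M j) end.
case=> {}P h /h s; suff: rel (Cut N a M) by [].
by case: s => x b L sL; split=> //; exists x.
Qed.

Lemma std_Sum A V (N : neg A V) : std_neg N -> exists2 F, N = Sum F & forall a, std_pos (F a).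
Proof. by case=> F h; exists F. Qed.

Lemma std_eq A :
  (forall V (Q : pos A V), (exists2 P, P =p Q & std_pos P) -> std_pos Q) /\
  (forall V (Q : neg A V), (exists2 P, P =n Q & std_neg P) -> std_neg Q).
Proof.
apply: std_coind => [V Q N a M [P e sP] /(eq_posr e)[N' [M' [c n m]]]|V N [N' e]].
  have [[x Nx] h] := std_conj sP c; subst N'.
  split; first by exists x; rewrite (eq_neg_Var n).
  by move=> j; exists (M' j).
case/std_Sum=> F NF h; subst N'; have [F' -> h'] := eq_neg_Sum e.
by exists F' => // a; exists (F a).
Qed.

Lemma std_ren A :
  (forall W (Q : pos A W), (exists V (r : V -> W) P, Q = ren_pos r P /\ std_pos P) ->
     std_pos Q) /\
  (forall W (Q : neg A W), (exists V (r : V -> W) P, Q = ren_neg r P /\ std_neg P) ->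
     std_neg Q).
Proof.
apply: std_coind => [W Q N a M [V [r [P [-> sP]]]]|W Q [V [r [N [-> sN]]]]].
  case/ren_conjV=> N0 [M0 [c -> ->]].
  have [[x ->] h] := std_conj sP c; rewrite ren_Var; split; first by exists (r x).
  by move=> j; exists V, r, (M0 j).
have [F -> h] := std_Sum sN; rewrite ren_Sum; eexists => // a.
by do 3!eexists; split; last exact: h.
Qed.

(** [var_arg P] says that some argument in [P] is a variable.  Substitution,
    reduction and normalization do not create such arguments, and a normal
    form without them is standard. *)
Inductive var_arg_pos A V : pos A V -> Prop :=
| Var_arg_head P N a M of conjunct P (Cut N a M) & var_arg_neg N : var_arg_pos P
| Var_arg_var P N a M j x of conjunct P (Cut N a M) & M j = Var x : var_arg_pos P
| Var_arg_arg P N a M j of conjunct P (Cut N a M) & var_arg_neg (M j) : var_arg_pos P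
with var_arg_neg A V : neg A V -> Prop :=
| Var_arg_Sum F a of var_arg_pos (F a) : var_arg_neg (Sum F).

Scheme var_arg_pos_min := Minimality for var_arg_pos Sort Prop
with var_arg_neg_min := Minimality for var_arg_neg Sort Prop.

Lemma var_arg_ind A (Cp : forall V, pos A V -> Prop) (Cn : forall V, neg A V -> Prop) :
  (forall V P N a M, conjunct P (Cut N a M) -> var_arg_neg N -> Cn V N -> Cp V P) ->
  (forall V P N a (M : 'I_(ar a) -> neg A V) j x, conjunct P (Cut N a M) ->
     M j = Var x -> Cp V P) ->
  (forall V P N a (M : 'I_(ar a) -> neg A V) j, conjunct P (Cut N a M) ->
     var_arg_neg (M j) -> Cn V (M j) -> Cp V P) ->
  (forall V F a, var_arg_pos (F a) -> Cp (V + 'I_(ar a))%type (F a) -> Cn V (Sum F)) ->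
  (forall V P, var_arg_pos P -> Cp V P) /\ (forall V N, var_arg_neg N -> Cn V N).
Proof.
move=> h1 h2 h3 h4.
by split=> V; [apply: (var_arg_pos_min h1 h2 h3 h4)
              | apply: (var_arg_neg_min h1 h2 h3 h4)].
Qed.

Lemma var_arg_std A :
  (forall V (P : pos A V), var_arg_pos P -> ~ std_pos P) /\
  (forall V (N : neg A V), var_arg_neg N -> ~ std_neg N).
Proof.
apply: (@var_arg_ind A (fun V P => ~ std_pos P) (fun V N => ~ std_neg N)) =>
  [V P N a M c g _ s|V P N a M j x c e s
                      |V P N a M j c _ IH s|V F a _ IH s].
- by have [[x Nx] _] := std_conj s c; subst N; inversion g.
- by have [_ /(_ j)] := std_conj s c; rewrite e => h; inversion h.
- by have [_ /(_ j)] := std_conj s c.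
- by have [F' [<-] /(_ a)] := std_Sum s.
Qed.

Lemma var_arg_ren A :
  (forall W (P : pos A W), var_arg_pos P -> forall V (r : V -> W) P0,
     P = ren_pos r P0 -> var_arg_pos P0) /\
  (forall W (N : neg A W), var_arg_neg N -> forall V (r : V -> W) N0,
     N = ren_neg r N0 -> var_arg_neg N0).
Proof.
apply: var_arg_ind => [W P N a M c _ IH V r P0 e|W P N a M j x c e V r P0 eP
                      |W P N a M j c _ IH V r P0 e|W F a _ IH V r N0].
- subst P; have [N0 [M0 [c0 e _]]] := ren_conjV c.
  by apply: Var_arg_head c0 _; exact: IH e.
- subst P; have [N0 [M0 [c0 _ eM]]] := ren_conjV c.
  move: e; rewrite eM; case E: (M0 j) => [y|F]; last by rewrite ren_Sum.
  by move=> _; exact: Var_arg_var c0 E.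
- subst P; have [N0 [M0 [c0 _ e]]] := ren_conjV c.
  by apply: Var_arg_arg c0 _; apply: IH; rewrite e.
- case: N0 => [y|F0]; rewrite ?ren_Var ?ren_Sum // => -[e].
  apply: (Var_arg_Sum (a := a)); by apply: IH; rewrite e.
Qed.

Lemma var_arg_sub A :
  (forall W (P : pos A W), var_arg_pos P -> forall V (s : V -> neg A W) P0,
     P = sub_pos s P0 -> var_arg_pos P0 \/ exists v, var_arg_neg (s v)) /\
  (forall W (N : neg A W), var_arg_neg N -> forall V (s : V -> neg A W) N0,
     N = sub_neg s N0 -> var_arg_neg N0 \/ exists v, var_arg_neg (s v)).
Proof.
apply: var_arg_ind => [W P N a M c _ IH V s P0 e|W P N a M j x c e V s P0 eP
                      |W P N a M j c _ IH V s P0 e|W F a f IH V s N0].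
- subst P; have [N0 [M0 [c0 e _]]] := sub_conjV c.
  case: (IH _ _ _ e) => [g|]; last by right.
  by left; exact: Var_arg_head c0 g.
- subst P; have [N0 [M0 [c0 _ eM]]] := sub_conjV c.
  move: e; rewrite eM; case E: (M0 j) => [y|F]; last by rewrite sub_Sum.
  by move=> _; left; exact: Var_arg_var c0 E.
- subst P; have [N0 [M0 [c0 _ e]]] := sub_conjV c.
  case: (IH _ s (M0 j)) => [|g|]; [by rewrite e | | by right].
  by left; exact: Var_arg_arg c0 g.
- case: N0 => [y|F0]; rewrite ?sub_Var ?sub_Sum => e.
    by right; exists y; rewrite -e; exact: Var_arg_Sum f.
  case: e => e; case: (IH _ _ (F0 a) (congr1 (fun f => f a) e)) => [g|[[v|j] g]].
  + by left; exact: Var_arg_Sum g.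
  + by right; exists v; exact: (var_arg_ren A).2 g _ _ _ erefl.
  + by inversion g.
Qed.

Lemma var_arg_reds A V (P Q : pos A V) : reds P Q -> var_arg_pos Q -> var_arg_pos P.
Proof.
elim=> // {}P R {}Q [F [b [M [c ->]]]] _ IH /IH h.
case: ((var_arg_sub A).1 _ _ h _ _ _ erefl) => [g|[[v|j] g]]; last exact: Var_arg_arg c g.
  by apply: Var_arg_head c _; exact: Var_arg_Sum g.
by inversion g.
Qed.

Lemma std_nf A :
  (forall V (Q : pos A V), (exists2 P, ~ var_arg_pos P & Q = nf_pos P) -> std_pos Q) /\
  (forall V (Q : neg A V),
     (exists2 F, ~ var_arg_neg (Sum F) & Q = nf_neg (Sum F)) -> std_neg Q).
Proof.
apply: std_coind => [V Q N a M [P nP ->]|V Q [F nF ->]].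
  case/nf_conjV=> [R [x [L [r c -> ->]]]]; split=> [|j]; first by exists x.
  case E: (L j) => [y|F].
    by case: nP; apply: (var_arg_reds r); exact: Var_arg_var c E.
  exists F => //; rewrite -E => g.
  by apply: nP; apply: (var_arg_reds r); exact: Var_arg_arg c g.
rewrite nf_Sum; exists (fun a => nf_pos (F a)) => // a.
by exists (F a) => // g; apply: nF; exact: Var_arg_Sum g.
Qed.

(** * Unary conjunctions *)

Lemma unary_coind A (Rp : forall V, pos A V -> Prop) (Rn : forall V, neg A V -> Prop) :
  (forall V P, Rp V P ->
     (P = Omega \/ exists2 S, conjunct P S & forall T, conjunct P T -> eq_pre S T) /\
     forall N a M, conjunct P (Cut N a M) -> Rn V N /\ forall j, Rn V (M j)) ->
  (forall V N, Rn V N -> (exists x, N = Var x) \/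
     exists2 F, N = Sum F & forall a, Rp _ (F a)) ->
  (forall V P, Rp V P -> unary_pos P) /\ (forall V N, Rn V N -> unary_neg N).
Proof.
move=> Hp Hn.
have Hp' V P : Rp V P ->
    (P = Omega \/ exists2 S, conjunct P S & forall T, conjunct P T -> eq_pre S T) /\
    forall S, conjunct P S ->
    match S with Cut N a M => Rn V N /\ forall j, Rn V (M j) end.
  by case/Hp=> h1 h2; split=> // -[N a M]; exact: h2.
pose pre_of V (sn : forall N, Rn V N -> unary_neg N) (S : pre A V) :=
  match S return match S with
    Cut N a M => Rn V N /\ forall j, Rn V (M j) end -> unary_pre S with
  | Cut N a M => fun r => match r with conj n m =>
      Unary_pre (sn _ n) (fun j => sn _ (m j)) end
  end.
pose sp := cofix sp V P (r : Rp V P) : unary_pos P :=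
  match Hp' V P r with conj e h =>
    Unary_pos e (fun S c => pre_of V (sn V) S (h S c)) end
with sn V N (r : Rn V N) : unary_neg N :=
  match Hn V N r with
  | or_introl (ex_intro x e) => match esym e in _ = N return unary_neg N with
    | erefl => @Unary_Var A V x end
  | or_intror (ex_intro2 F e h) => match esym e in _ = N return unary_neg N with
    | erefl => Unary_Sum (fun a => sp _ _ (h a)) end
  end for sp.
split; first exact: sp.
move=> V N /Hn[[x ->]|[F -> h]]; constructor => a; exact: sp.
Qed.

Lemma unary_conj A V (P : pos A V) N a M :
  unary_pos P -> conjunct P (Cut N a M) ->
  unary_neg N /\ forall j, unary_neg (M j).
Proof.
pose rel (S : pre A V) := match S with Cut N a M =>
  unary_neg N /\ forall j, unary_neg (M j) end.
case=> {}P _ h c; suff: rel (Cut N a M) by [].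
by case: (h _ c).
Qed.

Lemma ren_pre_eq A V W (r : V -> W) (S T : pre A V) :
  eq_pre S T -> eq_pre (ren_pre r S) (ren_pre r T).
Proof.
case=> N N' a M M' n m; rewrite [ren_pre _ _]unfold_preE [X in eq_pre _ X]unfold_preE.
by constructor=> [|j]; exact: ren_neg_eq.
Qed.

Lemma unary_ren A :
  (forall W (Q : pos A W), (exists V (r : V -> W) P, Q = ren_pos r P /\ unary_pos P) ->
     unary_pos Q) /\
  (forall W (Q : neg A W), (exists V (r : V -> W) P, Q = ren_neg r P /\ unary_neg P) ->
     unary_neg Q).
Proof.
apply: unary_coind => [W Q [V [r [P [-> uP]]]]|W Q [V [r [N [-> uN]]]]].
  split.
    case: uP => {}P [->|[S c h]] _; [left | right].
      by apply/ren_Omega.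
    case: S c h => [N a M] c h.
    exists (ren_pre r (Cut N a M)).
      by rewrite [ren_pre _ _]unfold_preE; exact: ren_conj.
    case=> N' b M' /ren_conjV[N1 [M1 [/h e -> ->]]].
    by have := ren_pre_eq r e; rewrite [X in eq_pre _ X]unfold_preE.
  move=> N a M /ren_conjV[N0 [M0 [c -> ->]]].
  have [un um] := unary_conj uP c.
  by split=> [|j]; [exists V, r, N0 | exists V, r, (M0 j)].
case: uN => [x|F h]; rewrite ?ren_Var ?ren_Sum; first by left; eexists.
by right; eexists => // a; do 3!eexists; split; last exact: h.
Qed.

Lemma std_ren_pos A V W (r : V -> W) (P : pos A V) : std_pos P -> std_pos (ren_pos r P).
Proof. by move=> sP; apply: (std_ren A).1; exists V, r, P. Qed.

Lemma unary_ren_pos A V W (r : V -> W) (P : pos A V) :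
  unary_pos P -> unary_pos (ren_pos r P).
Proof. by move=> uP; apply: (unary_ren A).1; exists V, r, P. Qed.

(** * Orthogonality and soundness *)

Local Open Scope classical_set_scope.

Lemma nf_ctx_refl A V (N : neg A V) : nf_ctx N N.
Proof.
apply: (@Nf_sub _ _ V N (fun x => Var x) (fun x => Var x)) => [||w].
- by apply: eqn_sym; apply: (sub_id _).2.
- by left; apply: eqn_sym; apply: (sub_id _).2.
- exact: Nf_var.
Qed.

Lemma nf_ctx_nf A V (N : neg A V) : nf_ctx N (nf_neg N).
Proof.
apply: (@Nf_sub _ _ V N (fun x => Var x) (fun x => Var x)) => [||w].
- by apply: eqn_sym; apply: (sub_id _).2.
- by right; apply: eqn_sym; apply: (sub_id _).2.
- exact: Nf_var.
Qed.

Lemma conv_cut_nf A V (N N' : neg A V) a (M M' : 'I_(ar a) -> neg A V) :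
  nf_ctx N N' -> (forall j, nf_ctx (M j) (M' j)) ->
  conv_cut N M <-> conv_cut N' M'.
Proof.
move=> hN hM; case: (nf_ctx_cut hN hM) => [[x -> ->]|[F [F' [-> -> h]]]].
  by split=> -[].
split=> -[G [<-] c]; eexists; first by [].
- exact: nf_ctx_conv h c.
- by [].
- exact: nf_ctx_convV h c.
Qed.

Lemma conv_plug_nf A (Q : design_pos A) N : conv (plug Q N) <-> conv (plug Q (nf_neg N)).
Proof.
have h : nf_ctx_pos (plug Q N) (plug Q (nf_neg N)).
  exists nat, Q, (fun v => if v == x0 then N else Var v),
    (fun v => if v == x0 then nf_neg N else Var v); split; [|exact: eqp_refl|by left].
  by move=> w; case: ifP => _; [exact: nf_ctx_nf | exact: Nf_var].
by split; [exact: nf_ctx_conv h | exact: nf_ctx_convV h].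
Qed.

Lemma orthogonalP A (P : design_pos A) N : orthogonal P N <-> conv (plug P N).
Proof. exact: convP. Qed.

Lemma single_eq A V (N N' : neg A V) a (M M' : 'I_(ar a) -> neg A V) :
  N =n N' -> (forall j, M j =n M' j) -> single (Cut N a M) =p single (Cut N' a M').
Proof.
move=> n m; split=> // [S [_ <-]|T [_ <-]].
  by exists (Cut N' a M'); [exists tt | constructor].
by exists (Cut N a M); [exists tt | constructor].
Qed.

Lemma sub_single A V W (s : V -> neg A W) N a M :
  sub_pos s (single (Cut N a M)) =
  single (Cut (sub_neg s N) a (fun j => sub_neg s (M j))).
Proof.
rewrite [LHS]unfold_posE /=; congr Conj; apply: funext => _.
by rewrite [LHS]unfold_preE.
Qed.

Lemma sub_closed A V (s : V -> neg A V) (N : neg A V) :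
  (forall x, ~ fv_neg x N) -> sub_neg s N =n N.
Proof.
move=> h; apply: (eqn_trans (Q := sub_neg (fun x => Var x) N)).
  by apply: sub_neg_ext => x /h.
by apply: (sub_id _).2.
Qed.

(** The arguments are closed, so plugging [N] only reaches the head: orthogonality to an action
    becomes convergence of a single cut. *)
Lemma conv_plug_act A (Q : design_pos A) a (M : 'I_(ar a) -> design_neg A) N :
  Q =p single (Cut (Var x0) a M) -> (forall j x, ~ fv_neg x (M j)) ->
  conv (plug Q N) <-> conv_cut N M.
Proof.
move=> e cM; rewrite -conv_single; apply: eq_conv.
apply: (eqp_trans (Q := sub_pos (fun v => if v == x0 then N else Var v)
                                (single (Cut (Var x0) a M)))).
  exact: sub_pos_eq.
rewrite sub_single sub_Var /=; apply: single_eq => // j.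
exact: sub_closed.
Qed.

Lemma std_single A V x a (M : 'I_(ar a) -> neg A V) :
  (forall j, std_neg (M j)) -> standard_pos (single (Cut (Var x) a M)).
Proof. by move=> h; split=> //; constructor=> _ [_ <-]; constructor. Qed.

Lemma fv_single A V x y a (M : 'I_(ar a) -> neg A V) :
  (forall j, ~ fv_neg x (M j)) -> fv_pos x (single (Cut (Var y) a M)) -> x = y.
Proof.
move=> h f.
have h' (S : pre A V) : fv_pre x S -> match S with Cut N b L =>
    fv_neg x N \/ exists j, fv_neg x (L j) end.
  by case=> [N b L|N b L j] g; [left | right; exists j].
have h2 (P : pos A V) : fv_pos x P -> exists2 S, conjunct P S & fv_pre x S.
  by case=> {}P S; exists S.
have [S [_ <-] /h' [g|[j /h//]]] := h2 _ f.
by inversion g.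
Qed.

Lemma act_pos_atomic (A : signature) (a : A) (X : 'I_(ar a) -> set (design_neg A)) :
  (forall j, X j `<=` @atomic_neg A) -> act_pos X `<=` @atomic_pos A.
Proof.
move=> hX P [M XM e].
have sM j : std_neg (M j) by have [] := hX _ _ (XM j).
have cM j x : ~ fv_neg x (M j) by have [_] := hX _ _ (XM j); apply.
have [_ s] := @std_single A nat x0 a M sM.
split; first split.
- by rewrite (eq_posO e).
- by apply: (std_eq A).1; exists (single (Cut (Var x0) a M)) => //; apply: eqp_sym.
move=> x f; apply: (@fv_single _ _ _ _ a M) => [j|]; first exact: cM.
exact: (fv_eq A).1 f _ e.
Qed.

Lemma biorth_incl A (Y : set (design_pos A)) :
  Y `<=` @atomic_pos A -> Y `<=` orth_neg (orth_pos Y).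
Proof. by move=> hY P YP; split=> [|N [_]]; [exact: hY | apply]. Qed.

Lemma orth3 A (Y : set (design_pos A)) :
  Y `<=` @atomic_pos A -> orth_pos (orth_neg (orth_pos Y)) = orth_pos Y.
Proof.
move=> hY; apply/seteqP; split=> N [aN h]; split=> // P YP.
  exact/h/biorth_incl.
by case: YP => _; apply; split.
Qed.

Definition acts A (al : connective A) (X : 'I_(conn_ar al) -> set (design_neg A)) :=
  \bigcup_(b in conn_acts al)
    act_pos (fun j : 'I_(ar (act_name b)) => X (tnth (act_vars b) j)).

Lemma acts_atomic A (al : connective A) X :
  (forall i, X i `<=` @atomic_neg A) -> @acts A al X `<=` @atomic_pos A.
Proof. by move=> hX P [b _]; apply: act_pos_atomic => j; exact: hX. Qed.

(** Internal completeness for the dual side: by the triple orthogonal law, the closure in [conn_pos]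
    can be forgotten and [K] tested against the generating actions alone. *)
Lemma orth_connP A (al : connective A) X K : (forall i, X i `<=` @atomic_neg A) ->
  orth_pos (conn_pos al X) K <-> atomic_neg K /\
    forall b, conn_acts al b -> forall M : 'I_(ar (act_name b)) -> design_neg A,
      (forall j, X (tnth (act_vars b) j) (M j)) -> conv_cut K M.
Proof.
move=> hX; have hA := acts_atomic hX.
rewrite /conn_pos -/(acts X) orth3 //; split=> -[aK h]; split=> //.
  move=> b alb M XM.
  have cM j x : ~ fv_neg x (M j) by have [_] := hX _ _ (XM j); apply.
  apply/(conv_plug_act K (eqp_refl (single (Cut (Var x0) (act_name b) M))) cM).
  by apply/orthogonalP; apply: h; exists b => //; exists M.
move=> P [b alb [M XM e]]; apply/orthogonalP.
have cM j x : ~ fv_neg x (M j) by have [_] := hX _ _ (XM j); apply.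
by apply/(conv_plug_act K e cM); apply: h.
Qed.

Lemma conn_pos_act A (al : connective A) X b M :
  (forall i, X i `<=` @atomic_neg A) -> conn_acts al b ->
  (forall j, X (tnth (act_vars b) j) (M j)) ->
  conn_pos al X (single (Cut (Var x0) (act_name b) M)).
Proof.
move=> hX alb XM; apply: biorth_incl; first exact: acts_atomic.
by exists b => //; exists M.
Qed.

Lemma orth_pos_atomic A (Y : set (design_pos A)) : orth_pos Y `<=` @atomic_neg A.
Proof. by move=> N []. Qed.

Lemma conn_pos_atomic A (al : connective A) X : conn_pos al X `<=` @atomic_pos A.
Proof. by move=> P []. Qed.

Lemma logical_neg_atomic A (X : set (design_neg A)) :
  logical_neg X -> X `<=` @atomic_neg A.
Proof. by case=> al Y _; exact: orth_pos_atomic. Qed.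

Lemma logical_neg_biorth A (X : set (design_neg A)) :
  logical_neg X -> orth_pos (orth_neg X) = X.
Proof. by case=> al Y _; rewrite /conn_neg orth3 //; exact: conn_pos_atomic. Qed.

Lemma logical_pos_behaviour A (X : set (design_pos A)) :
  logical_pos X -> behaviour_pos X.
Proof.
case=> al Y hY; rewrite /behaviour_pos /conn_pos -/(acts Y) orth3 //.
by apply: acts_atomic => i; exact: logical_neg_atomic.
Qed.

Lemma mem_dom A (G : context A) x X : List.In (x, X) G -> x \in dom G.
Proof.
elim: G => //= -[y Y] G IH [[-> _]|/IH]; rewrite /= in_cons ?eqxx // => ->.
by rewrite orbT.
Qed.

Lemma dom_mem A (G : context A) x : x \in dom G -> exists X, List.In (x, X) G.
Proof.
elim: G => //= -[y Y] G IH; rewrite in_cons => /orP[/eqP->|/IH[X]].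
  by exists Y; left.
by exists X; right.
Qed.

Lemma dom_cat A (G H : context A) : dom (G ++ H) = dom G ++ dom H.
Proof. exact: map_cat. Qed.

Lemma counter_atomic A (G : context A) K x :
  counter G K -> x \in dom G -> atomic_neg (K x).
Proof. by move=> cK /dom_mem[X /cK]; exact: orth_pos_atomic. Qed.

Lemma closing_in A (G : context A) K x : x \in dom G -> closing G K x = K x.
Proof. by rewrite /closing => ->. Qed.

(** The closure of [N] contains cuts, but neither [N] nor the designs of [K] have variables as
    arguments, so the normal form is standard; it is closed because the designs put for the
    variables of [G] are. *)
Lemma atomic_nf_closing A (G : context A) K N : counter G K -> std_neg N ->
  (forall x, fv_neg x N -> x \in dom G) ->
  atomic_neg (nf_neg (sub_neg (closing G K) N)).
Proof.
move=> cK sN fN; split=> [|x f].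
  have [F EN _] := std_Sum sN.
  apply: (std_nf A).2; rewrite EN sub_Sum; eexists => //; rewrite -sub_Sum -EN.
  move=> g; case: ((var_arg_sub A).2 _ _ g _ _ _ erefl) => [|[v]].
    by move/(var_arg_std A).2.
  rewrite /closing; case: ifP => [/(counter_atomic cK)[sK _]|_] h; last by inversion h.
  exact: (var_arg_std A).2 h sK.
have f' := (fv_nf A).2 _ _ _ f _ erefl.
have [v /fN vG] := (fv_sub A).2 _ _ _ f' _ _ _ erefl.
by rewrite closing_in //; have [_] := counter_atomic cK vG; apply.
Qed.

(** Turns satisfaction of a premise into membership in [X]. It has to be stated for the normal form,
    behaviours being made of atomic designs. *)
Lemma models_neg_nf A (G : context A) X N K : logical_neg X -> models_neg G X N ->
  counter G K -> X (nf_neg (sub_neg (closing G K) N)).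
Proof.
move=> lX [sN fN hN] cK; rewrite -(logical_neg_biorth lX); split.
  exact: atomic_nf_closing.
move=> Q XQ; apply/orthogonalP; apply: (conv_plug_nf _ _).1; apply/convP; exact: hN.
Qed.

Lemma sub_act_body A n (b : action A n) (y : 'I_n -> nat) P
    (s t : nat -> design_neg A) (M : 'I_(ar (act_name b)) -> design_neg A) :
  (forall x, fv_pos (inl x) P -> s x =n t x) ->
  (forall j, s (y (tnth (act_vars b) j)) =n M j) ->
  sub_pos s (act_body y P) =p sub_pos (cat_sub t M) P.
Proof.
move=> hs hM; apply: eqp_trans ((sub_ren _ _).1 _) _.
by apply: sub_pos_ext => -[x|j] f //=; exact: hs.
Qed.

Lemma In_act_context A n (b : action A n) y (X : 'I_n -> set (design_pos A)) x Z :
  List.In (x, Z) (act_context b y X) <->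
  exists j, x = y (tnth (act_vars b) j) /\ Z = X (tnth (act_vars b) j).
Proof.
rewrite /act_context; have -> : [seq (y i, X i) | i <- act_vars b] =
    [seq (y (tnth (act_vars b) j), X (tnth (act_vars b) j)) | j <- enum 'I_(ar (act_name b))].
  by rewrite -{1}(map_tnth_enum (act_vars b)) -map_comp.
rewrite List.in_map_iff; split=> [[j [[<- <-] _]]|[j [-> ->]]]; first by exists j.
exists j; split=> //; have : j \in enum 'I_(ar (act_name b)) by rewrite mem_enum.
by elim: (enum _) => //= i s IH; rewrite in_cons => /orP[/eqP->|/IH]; [left|right].
Qed.

Scheme derivable_pos_min := Minimality for derivable_pos Sort Prop
with derivable_neg_min := Minimality for derivable_neg Sort Prop.

Lemma In_cat T (x : T) (s t : seq T) : List.In x (s ++ t) <-> List.In x s \/ List.In x t.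
Proof. exact: List.in_app_iff. Qed.

(** * Soundness of the two rules *)

Lemma sound_pos_step A (G : context A) (P : design_pos A) z (al : connective A)
    (X : 'I_(conn_ar al) -> set (design_neg A)) (b : action A (conn_ar al)) M :
  sequent_pos G P -> (forall i, logical_neg (X i)) -> List.In (z, conn_pos al X) G ->
  conn_acts al b -> P =p single (Cut (Var z) (act_name b) M) ->
  (forall j, models_neg G (X (tnth (act_vars b) j)) (M j)) -> models_pos G P.
Proof.
move=> [lG [sP _] fP] lX zG alb e mM; split=> // K cK; apply/convP.
have e' := sub_pos_eq e (fun v => eqn_refl (closing G K v)).
apply: conv_eq _ (eqp_sym e'); rewrite sub_single sub_Var closing_in; last exact: mem_dom zG.
apply/conv_single.
have [_ h] := (orth_connP (K z) (fun i => logical_neg_atomic (lX i))).1 (cK _ _ zG).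
(* [K z] converges against tuples taken from the behaviours [X]; the closed arguments become such a
   tuple once normalized. *)
apply: (conv_cut_nf (nf_ctx_refl _) (fun j => nf_ctx_nf _)).2; apply: (h _ alb) => j.
exact: models_neg_nf.
Qed.

Lemma sound_neg_step A (G : context A) (al : connective A)
    (X : 'I_(conn_ar al) -> set (design_pos A)) F (y : 'I_(conn_ar al) -> nat) :
  sequent_neg G (conn_neg al X) (Sum F) -> (forall i, logical_pos (X i)) ->
  injective y -> (forall i, y i \notin dom G) ->
  (forall b, conn_acts al b ->
     models_pos (G ++ act_context b y X) (act_body y (F (act_name b)))) ->
  models_neg G (conn_neg al X) (Sum F).
Proof.
move=> [lG lN [sN _] fN] lX yI yG mF; split=> // K Q cK XQ; apply/convP.
suff XN : conn_neg al X (nf_neg (sub_neg (closing G K) (Sum F))).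
  by apply: (conv_plug_nf _ _).2; apply/orthogonalP; case: XQ => _; apply.
apply/orth_connP; first by move=> i; exact: orth_pos_atomic.
split=> [|b alb M XM]; first exact: atomic_nf_closing.
apply: (conv_cut_nf (nf_ctx_nf _) (fun j => nf_ctx_refl _)).1.
rewrite sub_Sum; eexists; first by [].
(* [K] extended by the challenge: the fresh name of the [j]-th bound variable is sent to [M j].
   Freshness keeps the cases apart, and distinctness of [act_vars b] makes [j] unique; the last
   [K v] is a default outside the extended context. *)
pose K' v := if v \in dom G then K v else
  if [pick j | y (tnth (act_vars b) j) == v] is Some j then M j else K v.
have K'M j : K' (y (tnth (act_vars b) j)) = M j.
  rewrite /K' (negbTE (yG _)); case: pickP => [i /eqP/yI e|/(_ j)]; last by rewrite eqxx.
  by rewrite (elimT (tuple_uniqP _) (act_uniq b) _ _ e).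
have cK' : counter (G ++ act_context b y X) K'.
  move=> x Z /In_cat[xG|/In_act_context[j [-> ->]]].
    by rewrite /K' (mem_dom xG); exact: cK.
  by rewrite K'M; exact: XM.
have [_ _ /(_ _ cK')/convP c] := mF b alb.
apply: conv_eq c _; apply: eqp_trans _ (eqp_sym (sub_inst _ _ _)).
apply: sub_act_body => [x f|j].
  have xG : x \in dom G by apply: fN; exact: Fv_Sum f.
  by rewrite !closing_in // ?dom_cat ?mem_cat ?xG //= /K' xG.
rewrite closing_in ?K'M // dom_cat mem_cat; apply/orP; right.
apply: (@mem_dom _ _ _ (X (tnth (act_vars b) j))).
by apply/In_act_context; exists j.
Qed.

Lemma soundness A :
  (forall (G : context A) P, derivable_pos G P -> models_pos G P) /\
  (forall (G : context A) X N, derivable_neg G X N -> models_neg G X N).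
Proof.
have hp (G : context A) P z al X (b : action A (conn_ar al)) M :
    sequent_pos G P -> (forall i, logical_neg (X i)) ->
    List.In (z, conn_pos al X) G -> conn_acts al b ->
    P =p single (Cut (Var z) (act_name b) M) ->
    (forall j, derivable_neg G (X (tnth (act_vars b) j)) (M j)) ->
    (forall j, models_neg G (X (tnth (act_vars b) j)) (M j)) -> models_pos G P.
  by move=> s lX zG alb e _; exact: sound_pos_step e.
have hn (G : context A) al X F (y : 'I_(conn_ar al) -> nat) :
    sequent_neg G (conn_neg al X) (Sum F) -> (forall i, logical_pos (X i)) ->
    injective y -> (forall i, y i \notin dom G) ->
    (forall b, conn_acts al b ->
      derivable_pos (G ++ act_context b y X) (act_body y (F (act_name b)))) ->
    (forall b, conn_acts al b ->
      models_pos (G ++ act_context b y X) (act_body y (F (act_name b)))) ->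
    models_neg G (conn_neg al X) (Sum F).
  by move=> s lX yI yG _; exact: sound_neg_step s lX yI yG.
split=> [G P|G X N]; first exact: derivable_pos_min hp hn _ _.
exact: derivable_neg_min hp hn _ _ _.
Qed.

(** * The counter-strategy *)

(** One tree [phi] codes both the positive behaviour [fpos phi] and the negative
    behaviour [fneg phi] obtained by alternating the two constructions. *)
Inductive form (A : signature) : Type :=
  Form (al : connective A) of ('I_(conn_ar al) -> form A).

Fixpoint interp A (phi : form A) : set (design_pos A) * set (design_neg A) :=
  match phi with Form al f =>
    (conn_pos al (fun i => (interp (f i)).2), conn_neg al (fun i => (interp (f i)).1))
  end.

Definition fpos A (phi : form A) := (interp phi).1.
Definition fneg A (phi : form A) := (interp phi).2.
Definition fconn A (phi : form A) := match phi with Form al _ => al end.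
Definition fsub A (phi : form A) : 'I_(conn_ar (fconn phi)) -> form A :=
  match phi with Form _ f => f end.

Lemma fposE A (phi : form A) : fpos phi = conn_pos (fconn phi) (fun i => fneg (fsub i)).
Proof. by case: phi. Qed.
Lemma fnegE A (phi : form A) : fneg phi = conn_neg (fconn phi) (fun i => fpos (fsub i)).
Proof. by case: phi. Qed.

Lemma form_logical A (phi : form A) : logical_pos (fpos phi) /\ logical_neg (fneg phi).
Proof. by elim: phi => al f IH; split; constructor => i; case: (IH i). Qed.

Scheme logical_pos_min := Minimality for logical_pos Sort Prop
with logical_neg_min := Minimality for logical_neg Sort Prop.

Lemma logical_form A :
  (forall X : set (design_pos A), logical_pos X -> exists phi, X = fpos phi) /\
  (forall X : set (design_neg A), logical_neg X -> exists phi, X = fneg phi).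
Proof.
have hp al (X : 'I_(conn_ar al) -> set (design_neg A)) :
    (forall i, logical_neg (X i)) -> (forall i, exists phi, X i = fneg phi) ->
    exists phi, conn_pos al X = fpos phi.
  move=> _ /choice[f hf]; exists (Form f).
  by rewrite /fpos /=; congr conn_pos; apply: funext.
have hn al (X : 'I_(conn_ar al) -> set (design_pos A)) :
    (forall i, logical_pos (X i)) -> (forall i, exists phi, X i = fpos phi) ->
    exists phi, conn_neg al X = fneg phi.
  move=> _ /choice[f hf]; exists (Form f).
  by rewrite /fneg /=; congr conn_neg; apply: funext.
split=> X lX.
  exact: (@logical_pos_min A (fun X => exists phi, X = fpos phi)
                             (fun X => exists phi, X = fneg phi) hp hn X lX).
exact: (@logical_neg_min A (fun X => exists phi, X = fpos phi)
                           (fun X => exists phi, X = fneg phi) hp hn X lX).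
Qed.

Definition fcontext A (G : seq (nat * form A)) : context A :=
  [seq (p.1, fpos p.2) | p <- G].

Lemma dom_fcontext A (G : seq (nat * form A)) : dom (fcontext G) = unzip1 G.
Proof. by rewrite /dom /fcontext -map_comp. Qed.

Lemma In_fcontext A (G : seq (nat * form A)) x X :
  List.In (x, X) (fcontext G) <-> exists2 phi, List.In (x, phi) G & X = fpos phi.
Proof.
rewrite List.in_map_iff; split=> [[[y phi] /= [e h]]|[phi h ->]]; last by exists (x, phi).
by case: e h => <- <- h; exists phi.
Qed.

Lemma logical_fcontext A (G : seq (nat * form A)) :
  uniq (unzip1 G) -> logical_context (fcontext G).
Proof.
move=> uG; have lG x X : List.In (x, X) (fcontext G) -> logical_pos X.
  by case/In_fcontext=> phi _ ->; case: (form_logical phi).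
by split=> //; split=> [|x X /lG]; [rewrite dom_fcontext | exact: logical_pos_behaviour].
Qed.

Lemma logical_context_form A (G : context A) :
  (forall x X, List.In (x, X) G -> logical_pos X) -> exists G', G = fcontext G'.
Proof.
elim: G => [|[x X] G IH] h; first by exists [::].
have [G' ->] := IH (fun y Y hY => h y Y (or_intror hY)).
have [phi ->] := (logical_form A).1 X (h x X (or_introl erefl)).
by exists ((x, phi) :: G').
Qed.

Lemma In_uniq T (G : seq (nat * T)) x phi psi : uniq (unzip1 G) ->
  List.In (x, phi) G -> List.In (x, psi) G -> phi = psi.
Proof.
have mem y t (H : seq (nat * T)) : List.In (y, t) H -> y \in unzip1 H.
  by elim: H => //= -[z u] H IH [[-> _]|/IH]; rewrite in_cons ?eqxx // => ->; rewrite orbT.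
elim: G => //= -[y t] G IH /andP[/negP yG uG] h1 h2.
case: h1 h2 => [[e1 e2]|h1] [[e3 e4]|h2]; subst.
- by [].
- by case: yG; exact: mem h2.
- by case: yG; exact: mem h1.
- exact: IH.
Qed.

Definition fresh (s : seq nat) (i : nat) : nat := (\max_(x <- s) x).+1 + i.

Lemma fresh_notin s i : fresh s i \notin s.
Proof.
apply/negP => h; have : fresh s i <= \max_(x <- s) x.
  exact: (@leq_bigmax_seq _ s xpredT id _ h isT).
by rewrite /fresh addSn ltnNge leq_addr.
Qed.

Lemma fresh_inj n s : injective (fun i : 'I_n => fresh s i).
Proof. by move=> i j /addnI/ord_inj. Qed.

(** A move records that the proof selected [z | a<M>] for the variable
    [mvar = z] and the name [mact = a], and that the premise [M j] with
    [j = mpremise] was followed, and then its component [mnext], whose bound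
    variables were named [mfresh].  Everything is kept in small types, as the
    moves will index a conjunction. *)
Record move (A : signature) := Move {
  mvar : nat; mact : A; mpremise : nat; mnext : A; mfresh : seq nat }.

(** Equality of cuts as an indexed family: a case analysis replaces head, name and arguments
    together, without equalities of dependent pairs. *)
Variant same_cut (A : signature) V (N : neg A V) (a : A) (M : 'I_(ar a) -> neg A V) :
    forall b : A, neg A V -> ('I_(ar b) -> neg A V) -> Prop :=
  Same_cut : same_cut N M N M.

Lemma Cut_inj (A : signature) V N a M N' b M' :
  Cut N' b M' = Cut N a M :> pre A V -> same_cut N M N' M'.
Proof.
pose rel (S : pre A V) := match S with Cut N' b M' => same_cut N M N' M' end.
by move=> e; suff: rel (Cut N' b M') by []; rewrite e.
Qed.

Section Strategy.
Context (A : signature) (played : move A -> Prop) (stuck : nat -> A -> Prop).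

Definition replies (z : nat) (a : A) :=
  {m : move A | [/\ played m, mvar m = z & mact m = a] /\ mpremise m < ar a}.

Definition reply_var (z : nat) (a : A) (p : replies z a) : 'I_(ar a) :=
  Ordinal (proj2 (projT2 p)).

(** The arguments of an answer are the strategies of the variables named when the corresponding
    premise was entered. An action that is neither stuck nor ever played on [z] receives the empty
    conjunction, that is, the daimon. The scope [V] is arbitrary because the design is closed. *)
CoFixpoint strat (V : Type) (z : nat) : neg A V :=
  Sum (fun a => if pselect (stuck z a) then Omega else
    Conj (replies z a) (fun p =>
      Cut (Var (inr (reply_var p))) (mnext (projT1 p))
          (* The default [0] is never reached for the moves of a branch, where [mfresh] has as many
             names as the arity of [mnext]. *)
          (fun k => strat (V + 'I_(ar a)) (nth 0 (mfresh (projT1 p)) k)))).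

Definition strat_body (V : Type) (z : nat) (a : A) : pos A (V + 'I_(ar a)) :=
  if pselect (stuck z a) then Omega else
    Conj (replies z a) (fun p =>
      Cut (Var (inr (reply_var p))) (mnext (projT1 p))
          (fun k => strat (V + 'I_(ar a)) (nth 0 (mfresh (projT1 p)) k))).

Lemma stratE V z : strat V z = Sum (strat_body V z).
Proof. by rewrite [LHS]unfold_negE. Qed.

Lemma strat_body_stuck V z a : stuck z a -> strat_body V z a = Omega.
Proof. by rewrite /strat_body; case: pselect. Qed.

Lemma strat_bodyP V z a : ~ stuck z a -> strat_body V z a <> Omega /\
  forall S, conjunct (strat_body V z a) S <-> exists m (j : 'I_(ar a)),
    [/\ played m, mvar m = z, mact m = a, mpremise m = j &
        S = Cut (Var (inr j)) (mnext m)
                (fun k => strat (V + 'I_(ar a)) (nth 0 (mfresh m) k))].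
Proof.
move=> nst; rewrite /strat_body; case: pselect => [/nst//|n].
split=> // S; split=> [[[m h] <-]|].
  by exists m, (reply_var (exist _ m h)); case: (h) => -[].
move=> [m [j [pm mz ma mj ->]]].
have h : [/\ played m, mvar m = z & mact m = a] /\ mpremise m < ar a.
  by split=> //; rewrite mj.
exists (exist _ m h) => /=.
by have -> : reply_var (exist _ m h) = j by apply: val_inj.
Qed.

(** Closedness in the form needed by reduction, which changes the scope of a strategy through
    substitutions. *)
Lemma sub_strat V W (s : V -> neg A W) z : sub_neg s (strat V z) =n strat W z.
Proof.
pose Rn W (N M : neg A W) := N =n M \/ exists V (s : V -> neg A W) z,
     N = sub_neg s (strat V z) /\ M = strat W z.
(* A body lives in a sum scope, whereas the relation ranges over all scopes: hence the equality
   [e]. *)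
pose Rp W (P Q : pos A W) := P =p Q \/ exists U V a (s : U -> neg A V) z
  (e : (V + 'I_(ar a))%type = W),
  P = eq_rect _ (pos A) (sub_pos (lift_sub s) (strat_body U z a)) _ e /\
  Q = eq_rect _ (pos A) (strat_body V z a) _ e.
have [_ h] : (forall W (P Q : pos A W), Rp W P Q -> P =p Q) /\
             (forall W (N M : neg A W), Rn W N M -> N =n M); last first.
  by apply: h; right; exists V, s, z.
apply: eq_coind => {V W s z} [W P Q|W N M [e|[V [s [z [-> ->]]]]]]; last first.
- right; rewrite !stratE sub_Sum; do 2!eexists; split=> // a.
  by right; exists V, W, a, s, z, erefl.
- by left.
case=> [e|[U [V [a [s [z [e []]]]]]]].
  split=> [|N a M c|N a M c]; first exact: eq_posO.
    have [N' [M' [c' n m]]] := eq_posl e c.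
    by exists N', M'; split=> // [|j]; left.
  have [N' [M' [c' n m]]] := eq_posr e c.
  by exists N', M'; split=> // [|j]; left.
case: W / e P Q => P Q /= -> ->.
case: (pselect (stuck z a)) => [st|nst].
  rewrite !strat_body_stuck //; split=> [|N b M|//]; first by rewrite sub_Omega.
  by move=> /sub_conjV[? [? []]].
have [nO1 h1] := strat_bodyP U nst; have [nO2 h2] := strat_bodyP V nst.
have sub_reply U' V' (t : U' -> neg A V') y : Rn V' (sub_neg t (strat U' y)) (strat V' y).
  by right; exists U', t, y.
split=> [|N b M|N b M].
- by rewrite sub_Omega.
- move=> /sub_conjV[N0 [M0 [c -> ->]]].
  have [m [j [pm mz ma mj E]]] := (h1 _).1 c.
  case: _ _ _ / (Cut_inj E).
  exists (Var (inr j)), (fun k => strat _ (nth 0 (mfresh m) k)); split.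
  + by apply/h2; exists m, j.
  + by rewrite sub_Var; left.
  + by move=> k; exact: sub_reply.
- move=> c; have [m [j [pm mz ma mj E]]] := (h2 _).1 c; case: _ _ _ / (Cut_inj E).
  do 2!eexists; split.
  + by apply: sub_conj; apply/h1; exists m, j.
  + by rewrite sub_Var; left.
  + by move=> k; exact: sub_reply.
Qed.

Lemma strat_std V z : std_neg (strat V z).
Proof.
suff: (forall W (P : pos A W), (exists V a z (e : (V + 'I_(ar a))%type = W),
     P = eq_rect _ (pos A) (strat_body V z a) _ e) -> std_pos P) /\
  (forall W (N : neg A W), (exists z, N = strat W z) -> std_neg N).
  by case=> _; apply; exists z.
apply: std_coind => {V z} [W P N b M|W N [z ->]]; last first.
  by rewrite stratE; eexists => // a; exists W, a, z, erefl.
case=> [V [a [z [e EP]]]]; case: W / e P EP N M => P /= -> N M.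
case: (pselect (stuck z a)) => [st|nst]; first by rewrite strat_body_stuck.
have [_ h1] := strat_bodyP V nst.
move=> c; have [m [j [_ _ _ _ E]]] := (h1 _).1 c; case: _ _ _ / (Cut_inj E).
by split=> [|k]; eexists.
Qed.

Lemma strat_atomic z : atomic_neg (strat nat z).
Proof.
split=> [|x f]; first exact: strat_std.
(* Up to bisimilarity the strategy is the image of its copy in the empty scope, which has no
   variable from which [x] could come. *)
have f' := (fv_eq A).2 _ _ _ f _ (eqn_sym (sub_strat (of_void (neg A nat)) z)).
by have [[]] := (fv_sub A).2 _ _ _ f' _ _ _ erefl.
Qed.
End Strategy.

(** * Completeness *)

Definition state (A : signature) := (seq (nat * form A) * design_pos A)%type.

Definition is_stuck A (s : state A) (z : nat) (a : A) : Prop :=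
  exists phi M, [/\ List.In (z, phi) s.1, s.2 =p single (Cut (Var z) a M) &
    forall b, conn_acts (fconn phi) b -> act_name b <> a].

Definition step A (s : state A) (m : move A) (t : state A) : Prop :=
  exists z phi b M j F b' y,
  let psi := fsub (tnth (act_vars b) j) in
  [/\ List.In (z, phi) s.1 /\ conn_acts (fconn phi) b,
      s.2 =p single (Cut (Var z) (act_name b) M) /\ M j = Sum F,
      conn_acts (fconn psi) b',
      m = Move z (act_name b) j (act_name b') [seq y i | i <- act_vars b'] &
      t = (s.1 ++ [seq (y i, fsub i) | i <- act_vars b'],
           act_body y (F (act_name b')))].

(** A branch that has ended idles, so that finite and infinite branches are both sequences indexed
    by [nat]. *)
Definition branch_next A (s t : state A) : Prop :=
  (exists m, step s m t) \/ t = s /\ (s.2 = Omega \/ exists z a, is_stuck s z a).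

(** The invariant of the branch. It asks for [std_pos] rather than [standard_pos], since a component
    reached by the branch may be [Omega]. *)
Definition refutable A (s : state A) : Prop :=
  [/\ uniq (unzip1 s.1), forall x, fv_pos x s.2 -> x \in unzip1 s.1,
      std_pos s.2, unary_pos s.2 & ~ derivable_pos (fcontext s.1) s.2].

Lemma act_contextE A n (b : action A n) y (f : 'I_n -> form A) G :
  fcontext (G ++ [seq (y i, f i) | i <- act_vars b]) =
  fcontext G ++ act_context b y (fun i => fpos (f i)).
Proof. by rewrite /fcontext map_cat -map_comp. Qed.

Lemma uniq_act_context T n (b : seq 'I_n) (y : 'I_n -> nat) (f : 'I_n -> T) G :
  injective y -> (forall i, y i \notin unzip1 G) -> uniq b -> uniq (unzip1 G) ->
  uniq (unzip1 (G ++ [seq (y i, f i) | i <- b])).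
Proof.
move=> yI yG ub uG; rewrite /unzip1 map_cat cat_uniq uG -map_comp /=.
rewrite (map_inj_uniq (f := fst \o _)) ?ub ?andbT; last by move=> i j /= /yI.
by apply/hasPn => _ /mapP[i _ ->] /=; exact: yG.
Qed.

Lemma fv_act_body A n (b : action A n) y P x : fv_pos x (act_body (A := A) (b := b) y P) ->
  fv_pos (inl x) P \/ exists j, x = y (tnth (act_vars b) j).
Proof.
move=> f; have [[v|j] f' ->] := (fv_ren A).1 _ _ _ f _ _ _ erefl; first by left.
by right; exists j.
Qed.

(** The rules read upwards. If the unary conjunct of [P] plays an available action, some premise of
    the positive rule is underivable; that premise is a sum, so with fresh names the negative rule
    yields an underivable component. *)
Lemma refutable_next A (s : state A) : refutable s -> exists2 t, refutable t & branch_next s t.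
Proof.
case: s => G P [/= uG fP sP unP nP].
case: (pselect (P = Omega)) => [PO|PnO].
  by exists (G, P) => //; right; split=> //; left.
have [S cS hS] : exists2 S, conjunct P S & forall T, conjunct P T -> eq_pre S T.
  by case: {fP sP nP} unP PnO => {}P [-> //|h] _ _.
case: S cS hS => [N a M] cP hP.
have eP : P =p single (Cut N a M).
  split=> // [T /hP e|T [_ <-]]; last first.
    by exists (Cut N a M) => //; constructor.
  exists (Cut N a M); first by exists tt.
  by case: e => *; constructor=> [|j]; apply: eqn_sym.
have [[z Nz] sM] := std_conj sP cP; have [_ uM] := unary_conj unP cP.
subst N; have zG : z \in unzip1 G by apply: fP; apply: Fv_heads cP _; constructor.
have [phi hphi] : exists phi, List.In (z, phi) G.
  elim: G zG {uG fP nP} => //= -[x phi] G IH; rewrite in_cons => /orP[/eqP->|/IH[psi]].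
    by exists phi; left.
  by exists psi; right.
case: (pselect (exists2 b, conn_acts (fconn phi) b & act_name b = a)); last first.
  move=> nb; exists (G, P) => //; right; split=> //; right; exists z, a, phi, M.
  by split=> // b hb e; apply: nb; exists b.
case=> b hb ba; subst a.
have [j hj] : exists j, ~ derivable_neg (fcontext G)
    (fneg (fsub (tnth (act_vars b) j))) (M j).
  apply: contrapT => hn; apply: nP.
  apply: (@Positive_rule A _ _ z (fconn phi) (fun i => fneg (fsub i)) b M) => //.
  - by split=> //; [exact: logical_fcontext | rewrite dom_fcontext].
  - by move=> i; case: (form_logical (fsub i)).
  - by apply/In_fcontext; exists phi; rewrite -?fposE.
  - by move=> j; apply: contrapT => hj; apply: hn; exists j.
have [F MF sF] := std_Sum (sM j).
set psi := fsub _ in hj.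
pose y := fun i : 'I_(conn_ar (fconn psi)) => fresh (unzip1 G) i.
have yG i : y i \notin unzip1 G by exact: fresh_notin.
have yI : injective y by exact: fresh_inj.
have fM x : fv_neg x (M j) -> x \in unzip1 G by move=> f; apply: fP; exact: Fv_args cP f.
have [b' hb' nD] : exists2 b', conn_acts (fconn psi) b' &
    ~ derivable_pos (fcontext G ++ act_context b' y (fun i => fpos (fsub i)))
                    (act_body y (F (act_name b'))).
  apply: contrapT => hn; apply: hj; rewrite fnegE MF.
  apply: (Negative_rule (y := y)) => //.
  - rewrite -fnegE -MF; split.
    + exact: logical_fcontext.
    + by case: (form_logical psi).
    + by split; [exact: sM | exact: uM].
    + by rewrite dom_fcontext.
  - by move=> i; case: (form_logical (fsub i)).
  - by move=> i; rewrite dom_fcontext.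
  - by move=> b' hb'; apply: contrapT => h; apply: hn; exists b'.
exists (G ++ [seq (y i, fsub i) | i <- act_vars b'], act_body y (F (act_name b'))).
  split=> /=.
  - by apply: uniq_act_context => //; exact: act_uniq.
  - move=> x /fv_act_body[f|[k ->]].
      rewrite /unzip1 map_cat mem_cat fM // MF; exact: Fv_Sum f.
    rewrite /unzip1 map_cat mem_cat -map_comp; apply/orP; right.
    by apply/mapP; exists (tnth (act_vars b') k) => //; exact: mem_tnth.
  - exact: std_ren_pos.
  - apply: unary_ren_pos.
    by have := uM j; rewrite MF => u; inversion u.
  - by rewrite act_contextE.
left; eexists; exists z, phi, b, M, j, F, b', y; split; by [].
Qed.

Lemma nth_act_vars A n (b : action A n) (y : 'I_n -> nat) (k : 'I_(ar (act_name b))) :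
  nth 0 [seq y i | i <- act_vars b] k = y (tnth (act_vars b) k).
Proof. by rewrite (nth_map (tnth (act_vars b) k)) ?size_tuple // -tnth_nth. Qed.

Lemma mem_In (T : eqType) (x : T) s : x \in s -> List.In x s.
Proof.
by elim: s => //= y s IH; rewrite in_cons => /orP[/eqP->|/IH]; [left|right].
Qed.

(** * Interaction of a branch with its strategies *)

Section Branch.
Context (A : signature) (st : nat -> state A).
Hypothesis stU : forall i, uniq (unzip1 (st i).1).
Hypothesis stN : forall i, branch_next (st i) (st i.+1).

Let played (m : move A) := exists i, step (st i) m (st i.+1).
Let stuck z a := exists i, is_stuck (st i) z a.
Let K := strat played stuck.

Lemma branch_mono i k z phi : List.In (z, phi) (st i).1 -> List.In (z, phi) (st (k + i)).1.
Proof.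
elim: k => // k IH /IH h; rewrite addSn; case: (stN (k + i)) => [[m]|[-> //]].
by case=> ? [? [? [? [? [? [? [? [_ _ _ _ ->]]]]]]]]; apply/In_cat; left.
Qed.

(** Contexts only grow, so both occurrences are found in a common later context, whose variables are
    distinct. *)
Lemma branch_uniq i k z phi psi : List.In (z, phi) (st i).1 ->
  List.In (z, psi) (st k).1 -> phi = psi.
Proof.
move=> /(branch_mono k) h1 /(branch_mono i).
by rewrite addnC; exact: (In_uniq (stU _)) h1.
Qed.

Lemma strat_orth phi : (forall i z, List.In (z, phi) (st i).1 -> orth_pos (fpos phi) (K nat z)).
Proof.
(* One move descends two levels, from [phi] through the premise to the fresh variables; the
   induction thus also covers immediate subtrees. *)
suff: (forall i z, List.In (z, phi) (st i).1 -> orth_pos (fpos phi) (K nat z)) /\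
  forall c i z, List.In (z, fsub (phi := phi) c) (st i).1 ->
    orth_pos (fpos (fsub c)) (K nat z) by case.
elim: phi => al f IH; split; last by move=> c; exact: (IH c).1.
move=> i z zG; rewrite fposE; apply/orth_connP => [c|].
  by apply: logical_neg_atomic; case: (form_logical (fsub c)).
split=> [|b alb M XM]; first exact: strat_atomic.
(* A stuck action is foreign to the connective of [z], and [z] has the same [phi] wherever it occurs
   in the branch. *)
have nst : ~ stuck z (act_name b).
  case=> i' [phi' [M' [zG' _ h]]].
  by have E := branch_uniq zG zG'; subst phi'; exact: h alb erefl.
rewrite /K stratE; eexists; first by [].
have [nO hb] := strat_bodyP played nat nst.
apply: conv_intro; first by rewrite sub_Omega.
move=> N c L /sub_conjV[N0 [L0 [cj -> ->]]].
have [m [j [[i' sm] mz ma mj E]]] := (hb _).1 cj.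
case: _ _ _ / (Cut_inj E).
case: sm mz ma mj => z' [phi' [b' [M' [j' [F [b2 [y]]]]]]] /=.
set psi := fsub _ => -[[zG' alb'] _ hb2 -> st'] /= Ez Eb Ej; subst z'.
have Ephi := branch_uniq zG' zG; subst phi'.
have Eb' : b' = b by exact: conn_names Eb.
subst b'; have Ej' : j' = j by exact: val_inj.
subst j'.
(* The roles are exchanged: [M j] is now the tested design, and the strategies of the fresh
   variables are its arguments, legitimate by induction. *)
have := XM j; rewrite /= -/psi fnegE => /orth_connP[c'|aN h].
  exact: orth_pos_atomic.
have {}h := h b2 hb2 (fun k => K nat (y (tnth (act_vars b2) k))).
have {}h : conv_cut (M j) (fun k => K nat (y (tnth (act_vars b2) k))).
  apply: h => k; apply: (IH _).2 (i'.+1) _ _; rewrite st' /=.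
  apply/In_cat; right; apply/List.in_map_iff.
  exists (tnth (act_vars b2) k); split; first by [].
  exact: mem_In (mem_tnth k (act_vars b2)).
apply: conv_cut_eq h _ _ => [|k]; first by rewrite sub_Var.
by rewrite nth_act_vars; apply: eqn_sym; exact: sub_strat.
Qed.

Lemma red_eq V (P Q : pos A V) F a M : Q =p P -> conjunct P (Cut (Sum F) a M) ->
  exists2 R, red Q R & R =p sub_pos (inst M) (F a).
Proof.
move=> e c; have [N [M' [c' n m]]] := eq_posr e c.
have [F' EN h] := eq_neg_Sum (eqn_sym n); subst N.
exists (sub_pos (inst M') (F' a)); first exact: red_Cut.
apply: sub_pos_eq => [|v]; [exact: eqp_sym | exact: eq_inst].
Qed.

(** A move of the branch is two reductions: [K z] receives the action, then the chosen premise
    receives the recorded answer. The resulting path contradicts the well-foundedness of [conv],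
    unless the branch ends and [Omega] is met. *)
Lemma branch_conv R : conv R -> forall i, R =p sub_pos (K nat) (st i).2 -> False.
Proof.
move=> cR; pose bad R := forall i, R =p sub_pos (K nat) (st i).2 -> False.
(* Strengthened to the immediate reducts, so that the hypothesis is available two reductions
   further. *)
suff: bad R /\ forall Q, red R Q -> bad Q by case.
elim: cR => {}R nO hv hr IH; split; last by move=> Q /IH[].
move=> i e.
have single_red z a M : (st i).2 =p single (Cut (Var z) a M) -> ~ stuck z a /\
    exists2 R1, red R R1 &
      R1 =p sub_pos (inst (fun j => sub_neg (K nat) (M j))) (strat_body played stuck nat z a).
  move=> eP; have {}e := eqp_trans e (sub_pos_eq eP (fun x => eqn_refl (K nat x))).
  move: e; rewrite sub_single sub_Var /K stratE => e.
  have [R1 r1 e1] := red_eq e (ex_intro _ tt erefl).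
  split; last by exists R1.
  move=> sz; move: e1; rewrite strat_body_stuck // => /eq_posO.
  by rewrite sub_Omega; case: (hr _ r1) => nO1 _ _ [_ /(_ erefl)].
case: (stN i) => [[m sm]|[_ [PO|[z [a sz]]]]]; last first.
- by case: (sz) => phi [M [_ /single_red[ns _] _]]; apply: ns; exists i.
- by apply: nO; rewrite (eq_posO e) PO sub_Omega.
case: (sm) => z [phi [b [M [j [F [b' [y /= [_ [eP MF] _ Em Est]]]]]]]].
have [ns [R1 r1 e1]] := single_red _ _ _ eP.
have [_ hb] := strat_bodyP played nat ns.
have cj : conjunct (strat_body played stuck nat z (act_name b))
    (Cut (Var (inr j)) (act_name b')
      (fun k => K _ (nth 0 [seq y i | i <- act_vars b'] k))).
  by apply/hb; exists m, j; rewrite Em; split=> //; exists i; rewrite -Em.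
have := sub_conj (inst (fun j => sub_neg (K nat) (M j))) cj.
rewrite sub_Var /= MF sub_Sum => {}cj.
have [R2 r2 e2] := red_eq e1 cj.
have [_ h] := IH _ r1; apply: (h _ r2 i.+1).
rewrite Est; apply: eqp_trans e2 _; apply: eqp_trans (sub_inst _ _ _) _.
apply: eqp_sym; apply: sub_act_body => // k.
by rewrite -nth_act_vars; apply: eqn_sym; exact: sub_strat.
Qed.
End Branch.

(** * Completeness of positive and negative sequents *)

Lemma completeness_pos A (G : context A) P :
  sequent_pos G P -> models_pos G P -> derivable_pos G P.
Proof.
move=> [[[uG bG] lG] [[_ sP] uP] fP] [_ _ mP]; apply: contrapT => nD.
have [G' EG] := logical_context_form lG; subst G.
have s0 : refutable (G', P) by split=> //=; rewrite -dom_fcontext.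
have ex_next (s : {s | refutable s}) : exists t : {s : state A | refutable s},
    branch_next (projT1 s) (projT1 t).
  by case: s => s rs; have [t rt h] := refutable_next rs; exists (exist _ t rt).
(* Dependent choice, on states carrying their invariant, produces the whole branch. *)
have [f hf] := choice ex_next.
pose st i := projT1 (iter i f (exist _ (G', P) s0)).
have stU i : uniq (unzip1 (st i).1) by rewrite /st; case: (iter _ _ _) => s /= [].
have stN i : branch_next (st i) (st i.+1) by exact: hf.
pose K := strat (fun m => exists i, step (st i) m (st i.+1))
                (fun z a => exists i, is_stuck (st i) z a) nat.
have cK : counter (fcontext G') K.
  move=> x X /In_fcontext[phi h ->]; exact: (strat_orth stU stN (i := 0)) h.
have /convP c := mP _ cK.
apply: (branch_conv stN c (i := 0)) => /=.
by apply: sub_pos_ext => x /fP xG; rewrite closing_in.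
Qed.

(** Answering the daimon to everything is orthogonal to any logical positive behaviour. Such a
    closing family excludes [Omega] among the components of a valid negative design. *)
Lemma counter_exists A (G : context A) :
  (forall x X, List.In (x, X) G -> logical_pos X) -> exists K, counter G K.
Proof.
move=> lG; exists (fun _ => Sum (fun _ => daimon)) => x X /lG[al Y lY].
apply/orth_connP => [i|]; first exact: logical_neg_atomic.
split=> [|b _ M _].
  split=> [|v f]; first by constructor=> a; constructor=> S [].
  have h (N : design_neg A) : fv_neg v N -> forall F, N = Sum F -> exists a, fv_pos (inl v) (F a).
    by case=> // F a g _ [<-]; exists a.
  have [a g] := h _ f _ erefl.
  have h2 V (x' : V) (P : pos A V) : fv_pos x' P -> exists S, conjunct P S.
    by case=> {}P S; exists S.
  by have [S []] := h2 _ _ _ g.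
eexists; first by [].
apply: conv_intro; first by rewrite sub_Omega.
by move=> N c L /sub_conjV[? [? [[]]]].
Qed.

(** Semantic inversion of the negative rule: the designs that [K] gives to the fresh variables are
    packed into an action on [x0], which belongs to the orthogonal of [conn_neg al X] and selects
    the component [b]. *)
Lemma models_component A (G : context A) (al : connective A)
    (X : 'I_(conn_ar al) -> set (design_pos A)) F (y : 'I_(conn_ar al) -> nat) b K :
  models_neg G (conn_neg al X) (Sum F) -> conn_acts al b ->
  counter (G ++ act_context b y X) K ->
  conv (sub_pos (closing (G ++ act_context b y X) K) (act_body y (F (act_name b)))).
Proof.
move=> [sF fF mF] alb cK.
have KX j : orth_pos (X (tnth (act_vars b) j)) (K (y (tnth (act_vars b) j))).
  by apply: cK; apply/In_cat; right; apply/In_act_context; exists j.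
have inD j : y (tnth (act_vars b) j) \in dom (G ++ act_context b y X).
  apply: (@mem_dom _ _ _ (X (tnth (act_vars b) j))).
  by apply/In_cat; right; apply/In_act_context; exists j.
have cG : counter G K by move=> x Z xG; apply: cK; apply/In_cat; left.
pose M j := K (y (tnth (act_vars b) j)).
have XQ : orth_neg (conn_neg al X) (single (Cut (Var x0) (act_name b) M)).
  apply: biorth_incl; first exact: conn_pos_atomic.
  by apply: conn_pos_act => // i; exact: orth_pos_atomic.
have cM j x : ~ fv_neg x (M j) by have [[_ h] _] := KX j; exact: h.
have /convP := mF K _ cG XQ.
move/(conv_plug_act _ (eqp_refl _) cM); rewrite sub_Sum => -[_ [<-]].
move=> c; apply: conv_eq c _; apply: eqp_trans (sub_inst _ _ _) _.
apply: eqp_sym; apply: sub_act_body => [x f|j]; last by rewrite closing_in.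
by rewrite !closing_in ?dom_cat ?mem_cat ?fF //; exact: Fv_Sum f.
Qed.

Lemma completeness_neg A (G : context A) X N :
  sequent_neg G X N -> models_neg G X N -> derivable_neg G X N.
Proof.
move=> [[[uG bG] lG] lX [sN uN] fN] mN.
have [F NF sF] := std_Sum sN; subst N; case: lX mN => al Y lY mN.
have uF a : unary_pos (F a) by inversion uN.
pose y := fun i : 'I_(conn_ar al) => fresh (dom G) i.
have yG i : y i \notin dom G by exact: fresh_notin.
have yI : injective y by exact: fresh_inj.
apply: (Negative_rule (y := y)) => // b alb.
have lD x Z : List.In (x, Z) (G ++ act_context b y Y) -> logical_pos Z.
  by case/In_cat=> [/lG//|/In_act_context[j [_ ->]]].
have cD K : counter _ K -> _ := @models_component _ _ _ _ _ y b K mN alb.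
have fD x : fv_pos x (act_body y (F (act_name b))) -> x \in dom (G ++ act_context b y Y).
  rewrite dom_cat mem_cat => /fv_act_body[f|[j ->]].
    by rewrite fN //; exact: Fv_Sum f.
  apply/orP; right; apply: (@mem_dom _ _ _ (Y (tnth (act_vars b) j))).
  by apply/In_act_context; exists j.
have sD : standard_pos (act_body y (F (act_name b))).
  split; last exact: std_ren_pos.
  have [K /cD[nO _ _]] := counter_exists lD.
  by move=> e; apply: nO; rewrite e sub_Omega.
apply: completeness_pos.
  split; [split; last exact: lD | split; [exact: sD | exact: unary_ren_pos] | exact: fD].
  split=> [|x Z /lD]; last exact: logical_pos_behaviour.
  exact: (@uniq_act_context _ _ (act_vars b) y Y G yI yG (act_uniq b) uG).
by split=> // K /cD c; apply/convP.
Qed.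

(** * Sequents made of a single behaviour *)

Lemma models_pos_closed A (X : set (design_pos A)) P : logical_pos X ->
  standard_pos P -> models_pos [:: (x0, X)] P <-> X P.
Proof.
move=> lX sP; have bX := logical_pos_behaviour lX.
have plugE (K : nat -> design_neg A) N : K x0 = N ->
    sub_pos (closing [:: (x0, X)] K) P =p plug P N.
  move=> <-; apply: sub_pos_ext => x _; rewrite /closing /= in_cons in_nil orbF.
  by case: eqP => // ->.
split=> [[_ fP mP]|XP].
  rewrite -bX; split=> [|N XN].
    by split=> // x /fP; rewrite /= in_cons in_nil orbF => /eqP.
  have cK : counter [:: (x0, X)] (fun _ => N) by move=> x Y [[_ <-]|[]].
  by apply/orthogonalP; apply/(eq_conv (plugE (fun _ => N) N erefl)); apply/convP/mP.
have [[_ fP] oP] : orth_neg (orth_pos X) P by rewrite bX.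
split=> // [x /fP->|K cK]; first by rewrite /= in_cons eqxx.
apply/convP/(eq_conv (plugE K _ erefl))/orthogonalP/oP.
by apply: cK; left.
Qed.

Lemma models_neg_closed A (X : set (design_neg A)) N : logical_neg X ->
  standard_neg N -> models_neg [::] X N <-> X N.
Proof.
move=> lX sN; have bX := logical_neg_biorth lX.
have plugE (K : nat -> design_neg A) Q :
    plug Q (sub_neg (closing [::] K) N) =p plug Q N.
  apply: sub_pos_ext => x _; case: ifP => // _.
  by apply: (sub_id _).2.
split=> [[_ fN mN]|XN].
  rewrite -bX; split=> [|Q XQ]; first by split=> // x /fN.
  apply/orthogonalP/(eq_conv (plugE (fun x => Var x) Q))/convP.
  by apply: mN.
have [[_ fN] oN] : orth_pos (orth_neg X) N by rewrite bX.
split=> // [x /fN//|K Q _ XQ].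
exact/convP/(eq_conv (plugE K Q))/orthogonalP/oN.
Qed.

Theorem theorem3p8 (A : signature) :
  [/\ forall (G : context A) (P : design_pos A),
        sequent_pos G P -> (derivable_pos G P <-> models_pos G P),
      forall (G : context A) (X : set (design_neg A)) (N : design_neg A),
        sequent_neg G X N -> (derivable_neg G X N <-> models_neg G X N),
      forall (X : set (design_pos A)) (P : design_pos A),
        logical_pos X -> proof_pos P ->
        (derivable_pos [:: (x0, X)] P <-> X P) &
      forall (X : set (design_neg A)) (N : design_neg A),
        logical_neg X -> proof_neg N ->
        (derivable_neg [::] X N <-> X N)].
Proof.
have [sp sn] := soundness A.
split=> [G P sP|G X N sN|X P lX [sP uP]|X N lX [sN uN]].
- by split; [exact: sp | exact: completeness_pos].
- by split; [exact: sn | exact: completeness_neg].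
- split=> [/sp/(models_pos_closed lX sP)//|/(models_pos_closed lX sP) mP].
  apply: completeness_pos => //; case: mP => _ fP _; split=> //.
  split; last by move=> x Y [[_ <-]|[]].
  by split=> // x Y [[_ <-]|[]]; exact: logical_pos_behaviour.
- split=> [/sn/(models_neg_closed lX sN)//|/(models_neg_closed lX sN) mN].
  by apply: completeness_neg => //; case: mN => _ fN _; split=> //; split.
Qed.
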